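(* There is a constant $C>0$ so that $$\eta_T(k)\le k+C\sqrt{k}\,\log k,$$ where $\eta_T(k)$ denotes the maximum size of a $k$-system of curves on the torus $T$.
   Context: $T\approx \mathbb{R}^2/\mathbb{Z}^2$ is the closed oriented surface of genus one. A ''curve'' on $T$ means the (unoriented) homotopy class of an essential simple closed curve on $T$. Curves on $T$ are in one-to-one correspondence with slopes $\mathbb{Q}\cup\{\infty\}$, where each slope is written $\frac pq$ with $p,q$ coprime integers, $(p,q)$ being taken up to overall sign, and $\infty=\frac10$. The intersection number of two curves is the minimum number of intersection points among representatives of the two homotopy classes; in terms of slopes it equals $\iota\left(\frac pq,\frac ab\right)=|pb-qa|$. A $k$-system is a collection of (distinct) curves such that any two of them have intersection number at most $k$. The quantity $\eta_T(k)$ is the maximum size of a $k$-system on $T$.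
   Formalization: The bound is stated for k ≥ 2 only: at k = 1 it fails, since the slopes 0, 1, ∞ form a 1-system of size 3 while k + C√k log k = 1, and at k = 0 log k is undefined. *)

(* Defs.v *)
From HB Require Import structures.
From mathcomp Require Import all_boot all_order all_algebra generic_quotient.
From mathcomp Require Import all_classical all_reals all_analysis.
Import Order.TTheory GRing.Theory Num.Theory.
Import numFieldNormedType.Exports.

Set Implicit Arguments.
Unset Strict Implicit.
Unset Printing Implicit Defensive.

Local Open Scope classical_set_scope.
Local Open Scope ring_scope.
Local Open Scope quotient_scope.
Local Open Scope card_scope.

(** The circle R/Z and the torus R^2/Z^2, with the quotient topologies. *)

Section Quotients.
Variable R : realType.

Definition circle_rel : rel R := fun x y => x - y \is a Num.int.

Lemma circle_rel_equiv : equiv_class_of circle_rel.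
Proof.
split=> [x|x y|y x z xy yz]; rewrite /circle_rel ?subrr ?rpred0 //.
- by rewrite -opprB rpredN.
- by rewrite -[x - z](subrKA y) rpredD.
Qed.

Canonical circle_equiv := EquivRelPack circle_rel_equiv.

Definition circle := quotient_topology {eq_quot circle_rel}.
HB.instance Definition _ := Topological.on circle.
HB.instance Definition _ := Quotient.on circle.

Definition torus_rel : rel (R * R) :=
  fun x y => circle_rel x.1 y.1 && circle_rel x.2 y.2.

Lemma torus_rel_equiv : equiv_class_of torus_rel.
Proof.
have [r s t] := circle_rel_equiv.
split=> [x|x y|y x z /andP[a b] /andP[c d]]; rewrite /torus_rel.
- by rewrite !r.
- by rewrite s [X in _ && X]s.
- by rewrite (t _ _ _ a c) (t _ _ _ b d).
Qed.

Canonical torus_equiv := EquivRelPack torus_rel_equiv.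

Definition torus := quotient_topology {eq_quot torus_rel}.
HB.instance Definition _ := Topological.on torus.
HB.instance Definition _ := Quotient.on torus.

End Quotients.

Section Curves.
Variable R : realType.
Implicit Types (f g : circle R -> torus R).
Implicit Types (a b : set (circle R -> torus R)).

Definition circle_opp (x : circle R) : circle R := \pi_(circle R) (- repr x).

(* Free homotopy: no base point is fixed. *)
Definition homotopic f g : Prop :=
  exists H : R * circle R -> torus R,
    [/\ {within `[0, 1]%classic `*` [set: circle R], continuous H},
        forall x, H (0, x) = f x &
        forall x, H (1, x) = g x].

Definition unoriented_homotopic f g : Prop :=
  homotopic f g \/ homotopic f (g \o circle_opp).

Definition simple_closed f : Prop := continuous f /\ injective f.

Definition essential f : Prop :=
  forall p : torus R, ~ homotopic f (fun=> p).

(* Representatives are required to be simple: intersection points are counted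
   below as points of the torus, so without this condition a representative
   could pass several times through a single intersection point and the minimum
   would not be the geometric intersection number. *)
Definition curve_class f : set (circle R -> torus R) :=
  [set g | simple_closed g /\ unoriented_homotopic f g].

Definition is_curve a : Prop :=
  exists f, [/\ simple_closed f, essential f & a = curve_class f].

(* Minimum of the number of intersection points over all pairs of
   representatives; [range f `&` range g] may be infinite for some pairs. *)
Definition is_intersection_number a b (n : nat) : Prop :=
  (exists f g, [/\ a f, b g & range f `&` range g #= `I_n]) /\
  (forall f g, a f -> b g -> `I_n #<= range f `&` range g).

Definition k_system (k : nat) (S : set (set (circle R -> torus R))) : Prop :=
  (forall a, S a -> is_curve a) /\
  (forall a b, S a -> S b -> a <> b ->
     exists2 n, (n <= k)%N & is_intersection_number a b n).

End Curves.

(* [is_eta R k n] says that n is the maximum size of a k-system; infinite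
   k-systems are not excluded a priori, but their existence would contradict
   the second clause. *)
Definition is_eta (R : realType) (k n : nat) : Prop :=
  (exists2 S, @k_system R k S & S #= `I_n) /\
  (forall S, @k_system R k S -> S #<= `I_n).

(* Main.v *)
(* The upper bound has a topological and an arithmetic half.

   Topology.  A simple closed curve on the torus lifts to a path [F] in the
   plane with [F (t + 1) = F t + u], where the integer vector [u] determines the
   free homotopy class.  Two applications of the Poincare-Miranda theorem give
   what is needed: if [u] is nonzero it is primitive, because otherwise some
   chord of the lift would be a lattice vector; and the lifts of two curves with
   vectors [u], [v] meet each other's integer translates, so that the curves
   have at least [|det (u, v)|] common points, one for each class of
   translates modulo the lattice spanned by [u] and [v].  A k-system is
   thus a set of primitive vectors, up to sign, with determinants at most [k].

   Arithmetic.  By Thue's lemma, an integral change of basis puts the vectors on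
   rows of height at most [2 sqrt k].  If [l j] is the extent of row [j],
   the determinants give [j * l i + i * l j <= 2 k]; adding these inequalities
   with weights [1 / (i j)] over the pairs of neighbouring denominators of the Farey
   sequence gives [sum_j (totient j / j) * l j <= k].  Row [j] contains
   [(totient j / j) * l j] vectors up to an error [O(2 ^ omega j)], and these errors add up
   to [O(sqrt k * log k)]. *)
Require Import Defs.
From mathcomp Require Import all_boot all_order all_algebra generic_quotient finmap.
From mathcomp Require Import all_classical all_reals all_analysis.
From mathcomp Require Import ring lra zify.

Set Implicit Arguments.
Unset Strict Implicit.
Unset Printing Implicit Defensive.

Import Order.TTheory GRing.Theory Num.Theory.
Import numFieldNormedType.Exports.

Local Open Scope ring_scope.

(** * Farey neighbours *)

(** Coprimality to [a] depends only on the residue modulo [a], so sliding the window by one trades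
    [m] for [m + a] at no change. *)
Lemma totient_window (a m : nat) :
  (\sum_(m <= b < m + a) coprime a b = totient a)%N.
Proof.
elim: m => [|m IH]; first by rewrite add0n totient_count_coprime.
case: a IH => [|a] IH; first by rewrite addn0 big_geq.
rewrite addnS big_nat_recr ?leq_addr //= -IH addSnnS.
rewrite [in RHS]big_ltn; last by lia.
rewrite addnC; congr (_ + _)%N.
by rewrite /coprime -[X in gcdn _ X]addnC gcdnDl.
Qed.

(* The consecutive denominators [(a, b)] of the Farey sequence of order [h]. *)
Definition farey (h a b : nat) : bool := coprime a b && (h < a + b)%N.

Lemma fareyC h a b : farey h a b = farey h b a.
Proof. by rewrite /farey coprime_sym addnC. Qed.

(** The condition [h < a + b] leaves for [b] the [a] consecutive integers that end at [h]. *)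
Lemma card_farey_row (a h : nat) : (0 < a <= h)%N ->
  (\sum_(1 <= b < h.+1) farey h a b = totient a)%N.
Proof.
case/andP=> a0 ah; rewrite -(totient_window a (h.+1 - a)).
rewrite subnK; last by lia.
rewrite (big_cat_nat (n := (h.+1 - a)%N)) /=; [|by lia|by lia].
rewrite big1_seq ?add0n.
  apply: eq_big_nat => b /andP[b1 b2]; rewrite /farey.
  by rewrite (_ : (h < a + b)%N) ?andbT //; lia.
move=> b /=; rewrite mem_index_iota => /andP[b1 b2].
by rewrite /farey (_ : (h < a + b)%N = false) ?andbF //; lia.
Qed.

Lemma coprime_subr (a n : nat) : (a <= n)%N -> coprime a (n - a) = coprime a n.
Proof. by move=> an; rewrite -{2}(subnKC an) /coprime gcdnDl. Qed.

(** Neighbouring Farey fractions with denominators [a], [b] lie [1 / (a b)] apart, and these gaps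
    fill the unit interval. The induction inserts mediants: at order [n] the pair [(a, n - a)] gives
    way to [(a, n)] and [(n, n - a)], of the same total weight. *)
Lemma sum_farey (R : realFieldType) (h : nat) : (0 < h)%N ->
  \sum_(1 <= a < h.+1) \sum_(1 <= b < h.+1 | farey h a b)
    ((a%:R * b%:R)^-1 : R) = 1.
Proof.
elim: h => // -[_ _|h /(_ isT) IH _].
  by rewrite big_nat1 big_mkcond big_nat1 /= mulr1 invr1.
set n := h.+2 in IH *.
pose T := \sum_(1 <= a < n | coprime a n) ((a%:R * n%:R)^-1 : R).
(* The pairs containing [n] contribute [T] for each position of [n]; [(n, n)] is not coprime, as
   [n >= 2]. *)
have E1 : \sum_(1 <= a < n.+1) \sum_(1 <= b < n.+1 | farey n a b)
    ((a%:R * b%:R)^-1 : R) =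
    \sum_(1 <= a < n) \sum_(1 <= b < n | farey n a b) (a%:R * b%:R)^-1 + T + T.
  rewrite big_nat_recr //=; congr (_ + _).
    rewrite /T [X in _ + X]big_mkcond -big_split /=.
    apply: eq_big_nat => a /andP[a1 an].
    rewrite !(big_mkcond (fun b => farey n a b)) big_nat_recr //=.
    by congr (_ + _); rewrite /farey (_ : (n < a + n)%N) ?andbT //; lia.
  rewrite big_mkcond big_nat_recr //= {2}/farey /coprime gcdnn /= addr0.
  rewrite /T [RHS]big_mkcond; apply: eq_big_nat => a /andP[a1 an].
  rewrite /farey coprime_sym [n%:R * _]mulrC.
  by rewrite (_ : (n < n + a)%N) ?andbT //; lia.
(* The pairs lost at order [n] are those with sum [n], where [b = n - a]. *)
have E2 : \sum_(1 <= a < n) \sum_(1 <= b < n | farey h.+1 a b)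
    ((a%:R * b%:R)^-1 : R) =
    \sum_(1 <= a < n) \sum_(1 <= b < n | farey n a b) (a%:R * b%:R)^-1 +
    \sum_(1 <= a < n | coprime a n) (a%:R * (n - a)%:R)^-1.
  rewrite [X in _ + X]big_mkcond -big_split /=.
  apply: eq_big_nat => a /andP[a1 an].
  rewrite !(big_mkcond (fun b => farey _ a b)).
  have -> : (if coprime a n then ((a%:R * (n - a)%:R)^-1 : R) else 0) =
    \sum_(1 <= b < n | b == (n - a)%N) (if coprime a b then (a%:R * b%:R)^-1 else 0).
    rewrite big_nat1_eq; rewrite (_ : (1 <= n - a < n)%N = true) /=; last by lia.
    by rewrite coprime_subr // ltnW.
  rewrite [X in _ + X]big_mkcond -big_split /=.
  apply: eq_big_nat => b /andP[b1 bn]; rewrite /farey.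
  case: (coprime a b) => /=; last by case: ifP; rewrite ?addr0.
  case: (ltngtP n (a + b)%N) => [nab|nab|nab].
  - by rewrite (_ : (b == n - a)%N = false) ?addr0 //; lia.
  - by rewrite (_ : (b == n - a)%N = false) ?addr0 //; lia.
  - by rewrite (_ : (b == n - a)%N = true) ?add0r //; lia.
rewrite E1 -[RHS]IH E2 -addrA; congr (_ + _).
(* Partial fractions split the weight of a lost pair between its two successors; reflecting [a] to
   [n - a] then turns the second half into [T]. *)
have E3 : \sum_(1 <= a < n | coprime a n) ((a%:R * (n - a)%:R)^-1 : R) =
  T + \sum_(1 <= a < n | coprime a n) (((n - a)%:R * n%:R)^-1 : R).
  rewrite -big_split /= big_seq_cond [RHS]big_seq_cond.
  apply: eq_bigr => a /andP[]; rewrite mem_index_iota => /andP[a1 an] _.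
  rewrite natrB ?(ltnW an) //.
  have : (a%:R : R) != 0 by rewrite pnatr_eq0; lia.
  have : (n%:R : R) != 0 by rewrite pnatr_eq0.
  have : (n%:R - a%:R : R) != 0 by rewrite subr_eq0 eqr_nat; lia.
  by move=> *; field; rewrite ?andbT; apply/and3P; split.
rewrite E3; congr (_ + _); rewrite /T big_nat_rev /= big_seq_cond [RHS]big_seq_cond.
apply: eq_big => a.
  rewrite mem_index_iota; case: (boolP (0 < a < n)%N) => //= /andP[a1 an].
  rewrite add1n subSS -coprime_subr ?leq_subr //.
  by rewrite subKn ?(ltnW an) // coprime_sym coprime_subr // ltnW.
by rewrite add1n subSS.
Qed.

(* Add up the hypotheses over the neighbours [(a, b)] of the Farey sequence of
   order [h], with weights [1 / (a b)]: each [a] occurs in [2 * totient a] pairs. *)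
Lemma totient_weighted_sum_le (R : realFieldType) (h : nat) (K : R) (l : nat -> R) :
  0 <= K ->
  (forall i j, (0 < i <= h)%N -> (0 < j <= h)%N -> j%:R * l i + i%:R * l j <= 2 * K) ->
  \sum_(1 <= j < h.+1) (totient j)%:R / j%:R * l j <= K.
Proof.
case: h => [|h]; first by rewrite big_geq.
set n := h.+1 => K0 H.
pose S := \sum_(1 <= a < n.+1) \sum_(1 <= b < n.+1 | farey n a b) (l a / a%:R).
have ES : S = \sum_(1 <= j < n.+1) (totient j)%:R / j%:R * l j.
  apply: eq_big_nat => a an; rewrite -(card_farey_row an) natr_sum.
  rewrite -mulrA mulr_suml big_mkcond; apply: eq_bigr => b _.
  by case: (farey n a b); rewrite ?mul0r ?mul1r // mulrC.
have ES' : S = \sum_(1 <= a < n.+1) \sum_(1 <= b < n.+1 | farey n a b) (l b / b%:R).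
  rewrite /S (exchange_big_dep xpredT) //=; apply: eq_bigr => a _.
  by apply: eq_bigl => b; rewrite fareyC.
(* The two forms of [S] together put [l a / a + l b / b] on each pair, at most [2 * K / (a b)] by
   hypothesis; the weights [1 / (a b)] sum to 1. *)
rewrite -ES; suff: S + S <= 2 * K by lra.
rewrite {1}ES' -[leRHS]mulr1 -[X in _ <= _ * X](sum_farey R (ltn0Sn h)) -big_split mulr_sumr /=.
apply: ler_sum_nat => a an; rewrite -big_split mulr_sumr /=.
rewrite big_mkcond [leRHS]big_mkcond /=.
apply: ler_sum_nat => b bn; case: ifP => // _.
have a0 : (0 : R) < a%:R by rewrite ltr0n; lia.
have b0 : (0 : R) < b%:R by rewrite ltr0n; lia.
have -> : l b / b%:R + l a / a%:R = (b%:R * l a + a%:R * l b) * (a%:R * b%:R)^-1.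
  by field; rewrite !gt_eqF.
by rewrite ler_wpM2r ?H // invr_ge0 mulr_ge0 // ltW.
Qed.

(** * Integers coprime to a modulus in an interval *)

Definition avoids (P : seq nat) (x : nat) : bool := all (fun p => ~~ (p %| x)%N) P.

Definition sieve (P : seq nat) (n : nat) : nat := (\sum_(1 <= x < n.+1) avoids P x)%N.

Lemma sieveS P n : sieve P n.+1 = (sieve P n + avoids P n.+1)%N.
Proof. by rewrite /sieve big_nat_recr. Qed.

(** Legendre's recursion: the multiples of [p] that avoid [P] are the [p * y] with [y] avoiding [P],
    because [p] is a prime outside [P]. *)
Lemma sieve_cons (p : nat) (P : seq nat) (n : nat) :
    prime p -> all prime P -> p \notin P ->
  (sieve (p :: P) n + sieve P (n %/ p) = sieve P n)%N.
Proof.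
move=> pp /allP Pp pP; elim: n => [|n IH].
  by rewrite div0n /sieve !big_geq.
have p0 := prime_gt0 pp.
have free_mul y : avoids P (p * y)%N = avoids P y.
  apply: eq_in_all => q qP; have qq := Pp q qP.
  rewrite Euclid_dvdM // dvdn_prime2 //.
  by case: eqP => // qp; rewrite -qp qP in pP.
rewrite divnS // !sieveS -IH /=; case: (boolP (p %| n.+1)%N) => pn /=; last first.
  by rewrite add0n; lia.
rewrite add1n sieveS addn0 -addnA; congr (_ + (_ + _))%N.
rewrite -free_mul -[in RHS](divnK pn) mulnC divnS // pn add1n.
by [].
Qed.

(** The divisor [d] is there for the induction: the recursion asks for the counts at [n / d] and
    [n / (d p)], so each prime doubles the error. *)
Lemma sieve_error (R : realFieldType) (P : seq nat) (n d : nat) :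
    (0 < d)%N -> all prime P -> uniq P ->
  `|(sieve P (n %/ d))%:R - n%:R / d%:R * \prod_(p <- P) (1 - p%:R^-1)| <= (2 ^ size P)%:R :> R.
Proof.
elim: P n d => [|p P IH] n d d0 /=.
  move=> _ _; rewrite big_nil mulr1 expn0 /sieve.
  have -> : (\sum_(1 <= x < (n %/ d).+1) avoids [::] x = n %/ d)%N.
    by rewrite sum_nat_const_nat muln1 subSS subn0.
  have dR : (0 : R) < d%:R by rewrite ltr0n.
  have r0 : 0 <= (n %% d)%:R / d%:R :> R by rewrite divr_ge0 ?ler0n.
  have r1 : (n %% d)%:R / d%:R <= 1 :> R.
    by rewrite ler_pdivrMr // mul1r ler_nat ltnW // ltn_mod.
  have -> : n%:R / d%:R = (n %/ d)%:R + (n %% d)%:R / d%:R :> R.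
    by rewrite {1}(divn_eq n d) natrD natrM mulrDl mulfK // gt_eqF.
  by rewrite ler_norml; apply/andP; split; lra.
case/andP=> pp Pp /andP[pP uP].
have := sieve_cons (n %/ d)%N pp Pp pP; rewrite -divnMA => /(congr1 (fun m => m%:R : R)).
rewrite natrD => E; rewrite big_cons.
have H1 := IH n d d0 Pp uP.
have H2 := IH n (d * p)%N _ Pp uP; rewrite muln_gt0 d0 prime_gt0 // in H2.
have {H2} := H2 isT; move: H1; rewrite natrM expnS mul2n -addnn natrD.
set Q := \prod_(_ <- _) _; rewrite !ler_norml => /andP[a1 a2] /andP[b1 b2].
have -> : n%:R / d%:R * ((1 - p%:R^-1) * Q) = n%:R / d%:R * Q - n%:R / (d%:R * p%:R) * Q :> R.
  by rewrite invfM; ring.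
by apply/andP; split; lra.
Qed.

Lemma totient_prod (R : realFieldType) (j : nat) : (0 < j)%N ->
  (totient j)%:R / j%:R = \prod_(p <- primes j) (1 - p%:R^-1) :> R.
Proof.
move=> j0; rewrite totientE // [X in _ / X%:R](prod_prime_decomp j0) prime_decompE.
rewrite big_map !natr_prod -prodf_div !big_seq; apply: eq_bigr => p pj /=.
have pp : prime p by move: pj; rewrite mem_primes => /andP[].
have l0 : (0 < logn p j)%N by rewrite logn_gt0.
have pR : (p%:R : R) != 0 by rewrite pnatr_eq0 -lt0n prime_gt0.
rewrite -[in X in _ / X](prednK l0) expnS !natrM natrX.
have -> : (p.-1%:R : R) = p%:R - 1 by rewrite -subn1 natrB // prime_gt0.
by field; rewrite pR expf_neq0.
Qed.

(** * Squarefree divisors *)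

Fixpoint subproducts (P : seq nat) : seq nat :=
  if P is p :: P' then subproducts P' ++ [seq p * x | x <- subproducts P']%N
  else [:: 1%N].

Lemma size_subproducts P : size (subproducts P) = (2 ^ size P)%N.
Proof. by elim: P => //= p P IH; rewrite size_cat size_map IH expnS mul2n addnn. Qed.

Lemma subproducts_prime P x q : all prime P -> prime q -> q \notin P ->
  x \in subproducts P -> ~~ (q %| x)%N.
Proof.
move=> + qp; elim: P x => [|p P IH] x /=.
  by move=> _ _; rewrite inE => /eqP ->; rewrite dvdn1; case: eqP qp => // ->.
case/andP=> pp Pp; rewrite inE negb_or => /andP[qNp qP]; rewrite mem_cat => /orP[xP|].
  exact: IH.
case/mapP=> y yP ->; rewrite Euclid_dvdM // negb_or dvdn_prime2 // qNp /=.
exact: IH.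
Qed.

Lemma uniq_subproducts P : all prime P -> uniq P -> uniq (subproducts P).
Proof.
elim: P => //= p P IH /andP[pp Pp] /andP[pP uP].
rewrite cat_uniq IH // map_inj_uniq ?IH //; last first.
  by move=> x y /eqP; rewrite eqn_pmul2l ?prime_gt0 // => /eqP.
rewrite andbT; apply/hasPn => x /mapP[y yP ->] /=.
by apply/negP => /(subproducts_prime Pp pp pP); rewrite dvdn_mulr.
Qed.

Lemma subproducts_dvd P n x : all prime P -> uniq P -> all (dvdn^~ n) P ->
  x \in subproducts P -> (x %| n)%N.
Proof.
elim: P n x => [|p P IH] n x /=.
  by move=> _ _ _; rewrite inE => /eqP ->; rewrite dvd1n.
case/andP=> pp Pp /andP[pP uP] /andP[pn Pn]; rewrite mem_cat => /orP[xP|].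
  exact: IH.
case/mapP=> y yP ->; rewrite Gauss_dvd ?pn ?IH //.
by rewrite prime_coprime // (subproducts_prime Pp).
Qed.

(** Products of sets of primes of [j] are distinct divisors of [j]. Unlike [2 ^ omega j], a count of
    divisors is easy to sum over [j]. *)
Lemma exp2_primes_le (j h : nat) : (0 < j <= h)%N ->
  (2 ^ size (primes j) <= \sum_(1 <= d < h.+1) (d %| j))%N.
Proof.
case/andP=> j0 jh.
have Pp : all prime (primes j).
  by apply/allP => p; rewrite mem_primes => /andP[].
have Pj : all (dvdn^~ j) (primes j).
  by apply/allP => p; rewrite mem_primes => /and3P[].
rewrite -size_subproducts -big_mkcond sum1_count -size_filter.
apply: uniq_leq_size; first by rewrite uniq_subproducts ?primes_uniq.
move=> x /(subproducts_dvd Pp (primes_uniq j) Pj) xj.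
rewrite mem_filter xj mem_index_iota (dvdn_gt0 j0 xj) ltnS /=.
exact: leq_trans (dvdn_leq j0 xj) jh.
Qed.

Lemma sum_dvdn (d h : nat) : (0 < d)%N -> (\sum_(1 <= j < h.+1) (d %| j) = h %/ d)%N.
Proof.
move=> d0; elim: h => [|h IH]; first by rewrite big_geq // div0n.
by rewrite big_nat_recr //= IH divnS // addnC.
Qed.

Lemma coprime_avoids x j : (0 < x)%N -> (0 < j)%N -> coprime x j = avoids (primes j) x.
Proof.
move=> x0 j0; rewrite coprime_sym coprime_has_primes // has_sym -all_predC.
apply: eq_in_all => p; rewrite mem_primes => /and3P[pp _ pj] /=.
by rewrite mem_primes pp x0.
Qed.

(** A shift to positive integers bounds the row by a difference of two sieve counts. Each has error
    [2 ^ omega j]; a third such term pays for the closed interval having [M - L + 1] integers. *)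
Lemma coprime_row_size (R : realFieldType) (j : nat) (X : seq int) (L M : int) :
    (0 < j)%N -> uniq X -> L <= M ->
    (forall x, x \in X -> [/\ L <= x, x <= M & coprimez x j]) ->
  (size X)%:R <= (totient j)%:R / j%:R * (M%:~R - L%:~R) + 3 * (2 ^ size (primes j))%:R :> R.
Proof.
move=> j0 uX LM HX.
(* A multiple of [j], which preserves coprimality to [j], large enough to make every [x + c]
   positive. *)
pose c : int := j%:Z * (`|L|%N.+1)%:Z.
have cL : 1 <= L + c.
  have := leq_pmull `|L|.+1 j0; rewrite /c -PoszM; lia.
pose f (x : int) := absz (x + c)%R.
pose l := f L; pose m := f M.
have fX : {subset [seq f x | x <- X] <=
    [seq x <- index_iota l m.+1 | avoids (primes j) x]}.
  move=> _ /mapP[x /HX[Lx xM xj] ->].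
  rewrite mem_filter mem_index_iota -coprime_avoids //; last by rewrite /f; lia.
  apply/andP; split; last by rewrite /l /m /f; lia.
  have : coprimez (x + c) j by rewrite /coprimez /c addrC gcdzC mulrC gcdzMDl gcdzC.
  by rewrite coprimezE.
have uf : uniq [seq f x | x <- X].
  rewrite map_inj_in_uniq // => x y /HX[Lx _ _] /HX[Ly _ _]; rewrite /f; lia.
have lm : (0 < l <= m)%N by rewrite /l /m /f; lia.
have le1 : (size X + sieve (primes j) l.-1 <= sieve (primes j) m)%N.
  have := uniq_leq_size uf fX; rewrite size_map size_filter -sum1_count big_mkcond /=.
  rewrite /sieve prednK; last by case/andP: lm.
  rewrite [in X in _ -> (_ <= X)%N](big_cat_nat (n := l)) /=; [|lia|lia].
  by rewrite addnC leq_add2l.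
have Pp : all prime (primes j).
  by apply/allP => p; rewrite mem_primes => /andP[].
have := @sieve_error R _ m 1 isT Pp (primes_uniq j).
have := @sieve_error R _ l.-1 1 isT Pp (primes_uniq j).
rewrite !divn1 !divr1 -totient_prod //.
set e := (2 ^ _)%:R; set q := _%:R / j%:R; move: le1; rewrite -(ler_nat R) natrD.
have e1 : 1 <= e by rewrite ler1n expn_gt0.
have q1 : q <= 1.
  rewrite /q ler_pdivrMr ?ltr0n // mul1r ler_nat totient_count_coprime.
  rewrite -[leqRHS]card_ord -sum1_card big_mkord; apply: leq_sum => i _.
  exact: leq_b1.
have ml : m%:R - l.-1%:R = M%:~R - L%:~R + 1 :> R.
  have mE : m%:Z = M + c by rewrite /m /f; lia.
  have lE : l.-1%:Z = L + c - 1 by rewrite /l /f; lia.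
  by rewrite -[m%:R]/(m%:Z%:~R) -[l.-1%:R]/(l.-1%:Z%:~R) mE lE !rmorphB !rmorphD /=; ring.
rewrite !ler_norml => Hs /andP[a1 a2] /andP[b1 b2].
have : q * (m%:R - l.-1%:R) <= q * (M%:~R - L%:~R) + 1 by rewrite ml; lra.
rewrite mulrBr ![q * _%:R]mulrC; lra.
Qed.

(** * Primitive vectors with bounded determinants *)

Definition det2 (R : pzRingType) (u v : R * R) : R := u.1 * v.2 - u.2 * v.1.

Definition level (V : seq (int * int)) (j : nat) : seq int :=
  [seq v.1 | v <- V & v.2 == j%:Z].

Lemma mem_level V j x : (x \in level V j) = ((x, j%:Z) \in V).
Proof.
apply/mapP/idP => [[[a b]]|xV]; last by exists (x, j%:Z); rewrite // mem_filter /= eqxx.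
by rewrite mem_filter /= => /andP[/eqP -> abV] ->.
Qed.

Lemma level_uniq V j : uniq V -> uniq (level V j).
Proof.
move=> uV; rewrite map_inj_in_uniq ?filter_uniq // => -[a b] [c d].
by rewrite !mem_filter /= => /andP[/eqP -> _] /andP[/eqP -> _] ->.
Qed.

Lemma seq_extrema (X : seq int) : X != [::] ->
  exists L M, [/\ L \in X, M \in X & forall x, x \in X -> L <= x <= M].
Proof.
elim: X => // x [|y X] IH _.
  by exists x, x; split; rewrite ?mem_head // => z; rewrite inE => /eqP ->; rewrite lexx.
have [//|L [M [LX MX H]]] := IH.
exists (Num.min x L), (Num.max x M); split.
- by rewrite minEle; case: ifP => _; rewrite in_cons ?eqxx ?LX ?orbT.
- by rewrite maxEle; case: ifP => _; rewrite in_cons ?eqxx ?MX ?orbT.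
- move=> z; rewrite in_cons => /orP[/eqP -> | /H /andP[h1 h2]].
    by rewrite ge_min le_max lexx.
  by rewrite ge_min le_max h1 h2 !orbT.
Qed.

(** Empty top rows are removed by induction on [h]. Otherwise the extents [l j] satisfy the
    hypothesis of [totient_weighted_sum_le], and [coprime_row_size] turns extents into counts; row 0
    accounts for the summand 1. *)
Lemma size_rows_le (R : realFieldType) (k h : nat) (V : seq (int * int)) :
    uniq V ->
    (forall v, v \in V -> coprimez v.1 v.2) ->
    (forall v, v \in V -> 0 <= v.2 <= h%:Z) ->
    (forall v, v \in V -> v.2 = 0 -> v.1 = 1) ->
    (forall u v, u \in V -> v \in V -> `|det2 u v| <= k%:Z) ->
  (size V)%:R <= 1 + k%:R + 3 * \sum_(1 <= j < h.+1) (2 ^ size (primes j))%:R :> R.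
Proof.
move=> uV cV; elim: h => [|h IH] Vh V0 Vk.
  rewrite big_geq // mulr0 addr0 (_ : 1 + k%:R = (1 + k)%:R); last by rewrite natrD.
  rewrite ler_nat.
  apply: (@leq_trans 1); last by rewrite leq_addr.
  apply: (@uniq_leq_size _ _ [:: (1, 0)]) => // v vV.
  have v2 : v.2 = 0 by apply: le_anti; rewrite andbC; apply: Vh.
  by rewrite inE [v]surjective_pairing v2 (V0 v vV v2).
have [top0|topN] := eqVneq (level V h.+1) [::].
  apply: (le_trans (IH _ V0 Vk)).
    move=> [a b] abV; have /andP[/= b0 bh] := Vh _ abV; rewrite b0 /=.
    rewrite -ltzD1 lt_neqAle -[h%:Z + 1]/((h + 1)%N%:Z) addn1 bh andbT.
    by apply/eqP => bE; have := mem_level V h.+1 a; rewrite top0 -bE abV.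
  by rewrite [in leRHS]big_nat_recr //= mulrDr addrA lerDl mulr_ge0.
(* [b j] holds the two ends of row [j]; for an empty row they coincide, so that [l j = 0]. *)
pose P j (b : int * int) := b.1 <= b.2 /\
    if level V j == [::] then b.1 = b.2 else
    [/\ b.1 \in level V j, b.2 \in level V j &
        forall x, x \in level V j -> b.1 <= x <= b.2].
have /boolp.choice[b /all_and2[ble Hb]] : forall j, exists b, P j b.
  move=> j; rewrite /P; have [r0|rN] := eqVneq (level V j) [::]; first by exists (0, 0).
  have [L [M [LX MX H]]] := seq_extrema rN; exists (L, M); split => //=.
  by have /andP[] := H _ LX.
pose l j : R := (b j).2%:~R - (b j).1%:~R.
have det_row i j x y : x \in level V i -> y \in level V j ->
    `|x * j%:Z - i%:Z * y| <= k%:Z.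
  by rewrite !mem_level => /Vk H /H.
have lR i j : (j%:Z * ((b i).2 - (b i).1) + i%:Z * ((b j).2 - (b j).1) <= 2 * k%:Z) ->
   j%:R * l i + i%:R * l j <= 2 * k%:R.
  move=> H; have := H; rewrite -(ler_int R).
  by rewrite rmorphD !rmorphM !rmorphB.
(* An empty row inherits the constraint of the top row, which is not empty. *)
have empty_row i j : (0 < i <= h.+1)%N -> level V i = [::] -> level V j != [::] ->
    i%:Z * ((b j).2 - (b j).1) <= 2 * k%:Z.
  move=> ih i0 jN; have := Hb j; rewrite (negbTE jN) => -[h1 h2 _].
  have := Hb h.+1; rewrite (negbTE topN) => -[t1 _ _].
  have := det_row _ _ _ _ t1 h1; have := det_row _ _ _ _ t1 h2.
  have := ble j; move: ih; nia.
have Hl i j : (0 < i <= h.+1)%N -> (0 < j <= h.+1)%N ->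
    j%:R * l i + i%:R * l j <= 2 * k%:R.
  move=> ih jh; apply: lR.
  have := Hb i; have := Hb j.
  have [ri|rNi] := eqVneq (level V i) [::]; have [rj|rNj] := eqVneq (level V j) [::].
  - by move=> -> ->; rewrite !subrr !mulr0.
  - by move=> _ ->; rewrite subrr mulr0 add0r empty_row.
  - by move=> -> _; rewrite subrr mulr0 addr0 empty_row.
  (* Two determinants between opposite ends of the rows differ by [j * l i + i * l j]. *)
  - move=> [j1 j2 _] [i1 i2 _].
    have := det_row _ _ _ _ i1 j2; have := det_row _ _ _ _ i2 j1.
    nia.
have sizeE : (size V = \sum_(0 <= j < h.+2) size (level V j))%N.
  under eq_bigr do rewrite size_map size_filter -sum1_count big_mkcond /=.
  rewrite exchange_big /= -sum1_size big_seq [RHS]big_seq.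
  apply: eq_bigr => -[a c] /Vh /= /andP[v0 vh].
  rewrite (bigD1_seq (absz c)) ?iota_uniq //=; last by rewrite mem_index_iota; lia.
  rewrite gez0_abs // eqxx big1_seq // => i /andP[iv _].
  by case: eqP => // vi; move: iv; rewrite vi eqxx.
have row0 : (size (level V 0) <= 1)%N.
  apply: (@uniq_leq_size _ _ [:: 1]); first exact: level_uniq.
  by move=> x; rewrite mem_level inE => /V0 /= ->.
rewrite sizeE big_ltn // natrD -addrA lerD ?ler_nat //.
  by rewrite -[1]/(1%:R) ler_nat.
have := @totient_weighted_sum_le R h.+1 k%:R l (ler0n _ _) Hl.
move=> Hsum; apply: (@le_trans _ _ (\sum_(1 <= j < h.+2)
    ((totient j)%:R / j%:R * l j + 3 * (2 ^ size (primes j))%:R))); last first.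
  by rewrite big_split /= mulr_sumr lerD2r.
rewrite natr_sum; apply: ler_sum_nat => j /andP[j1 jh].
apply: (coprime_row_size _ _ (level_uniq _ uV)) => // x xr.
have := Hb j; case: eqP => [r0|_ [_ _ /(_ x xr)/andP[-> ->]]]; first by rewrite r0 in xr.
by split => //; rewrite mem_level in xr; have := cV _ xr.
Qed.

(** * Reduction of the slopes to low rows *)

Lemma sqrtn_exists (D : nat) : exists m, (m ^ 2 <= D < m.+1 ^ 2)%N.
Proof.
elim: D => [|D [m /andP[h1 h2]]]; first by exists 0%N.
have [h|h] := ltnP D.+1 (m.+1 ^ 2); first by exists m; rewrite h ltnW ?ltnS.
by exists m.+1; rewrite h /=; rewrite !expnS !expn0 in h1 h2 h *; nia.
Qed.

(* Thue's lemma: a pigeonhole argument modulo the lattice spanned by the values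
   of [y] on [(u, v)], whose index is [det2 u v]. *)
Lemma small_form (u v : int * int) (D m : nat) :
    coprimez u.1 u.2 -> `|det2 u v| = D%:Z -> (0 < D)%N -> (D < m.+1 ^ 2)%N ->
  exists p q : int, [/\ (p != 0) || (q != 0),
    `|p * u.1 + q * u.2| <= m%:Z & `|p * v.1 + q * v.2| <= m%:Z].
Proof.
move=> /coprimezP[[r s] /= rs] uvD D0 Dm.
(* A form with value [A] at [u] is [A * (r, s)] plus a multiple of [(- u.2, u.1)], so at [v] it is
   [A * c] modulo [det2 u v]. More than [D] pairs [(a, b)] share [D] residues of [b - a * c]; the
   difference of two with equal residues is a pair of values. *)
pose c := r * v.1 + s * v.2.
pose f (x : 'I_m.+1 * 'I_m.+1) : 'I_D.-1.+1 :=
  inord (absz (((x.2 : nat)%:Z - (x.1 : nat)%:Z * c) %% D)%Z).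
have /injectivePn[[a b] [[a' b'] ab ff]] : ~~ injectiveb f.
  apply/negP => /injectiveP /leq_card; rewrite card_prod !card_ord prednK //.
  by rewrite leqNgt mulnn Dm.
have Dnz : (D%:Z != 0) by lia.
have modE x : (absz (x %% D)%Z < D.-1.+1)%N.
  by rewrite prednK // -ltz_nat gez0_abs ?modz_ge0 // ltz_pmod // ltz_nat.
have /eqP : (((b : nat)%:Z - (a : nat)%:Z * c) = ((b' : nat)%:Z - (a' : nat)%:Z * c) %[mod D])%Z.
  have /(congr1 val) := ff; rewrite /f /= !inordK //.
  by move=> /(congr1 Posz); rewrite !gez0_abs ?modz_ge0.
rewrite eqz_mod_dvd => /dvdzP[t tE].
pose A := (a : nat)%:Z - (a' : nat)%:Z; pose B := (b : nat)%:Z - (b' : nat)%:Z.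
have BE : B = A * c + t * D%:Z by rewrite /A /B -tE; ring.
have [e eE] : exists e, e * det2 u v = D%:Z.
  have : (`|det2 u v| = det2 u v) \/ (`|det2 u v| = - det2 u v).
    by case: (ger0P (det2 u v)); [left|right].
  by rewrite uvD => -[] ->; [exists 1|exists (-1)]; rewrite ?mul1r ?mulN1r.
have AE : (A * r - t * e * u.2) * u.1 + (A * s + t * e * u.1) * u.2 = A.
  by rewrite -[RHS]mulr1 -rs; ring.
have BE' : (A * r - t * e * u.2) * v.1 + (A * s + t * e * u.1) * v.2 = B.
  by rewrite BE -eE /c /det2; ring.
exists (A * r - t * e * u.2), (A * s + t * e * u.1); split.
- apply/negPn/negP; rewrite negb_or !negbK => /andP[/eqP p0 /eqP q0].
  move: AE BE'; rewrite p0 q0 !mul0r addr0 => A0 B0; case/negP: ab.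
  by apply/eqP; congr (_, _); apply: val_inj => /=; rewrite /A /B in A0 B0; lia.
- by rewrite AE /A; move: (ltn_ord a) (ltn_ord a'); lia.
- by rewrite BE' /B; move: (ltn_ord b) (ltn_ord b'); lia.
Qed.

(** Bezout coefficients of [u] express [v] as [e * u]; those of [v] show that [e] is a unit. *)
Lemma coprime_det2_eq0 (u v : int * int) :
    coprimez u.1 u.2 -> coprimez v.1 v.2 -> det2 u v = 0 ->
  u = v \/ u = (- v.1, - v.2).
Proof.
case: u v => [a b] [c d] /= /coprimezP[[r s] /= rs] /coprimezP[[r' s'] /= rs'] /eqP.
rewrite /det2 /= subr_eq0 => /eqP E.
pose e := r * c + s * d; pose e' := r' * a + s' * b.
have cE : c = e * a.
  have -> : e * a = r * c * a + s * (a * d) by rewrite /e; ring.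
  by rewrite E -[LHS]mul1r -rs; ring.
have dE : d = e * b.
  have -> : e * b = r * (b * c) + s * d * b by rewrite /e; ring.
  by rewrite -E -[LHS]mul1r -rs; ring.
have ee : e' * e = 1 by rewrite -rs' cE dE /e'; ring.
have e1 : `|e|%N = 1%N.
  by apply/eqP; rewrite -dvdn1; apply/dvdnP; exists `|e'|%N; rewrite -abszM ee.
have [e1'|e1'] : e = 1 \/ e = -1 by lia.
  by left; rewrite cE dE e1' !mul1r.
by right; rewrite cE dE e1' !mulN1r !opprK.
Qed.

(** Both signs stand for the same slope; this choice makes rows nonnegative and leaves only [(1, 0)]
    for coprime pairs on row 0. *)
Definition normalize (z : int * int) : int * int :=
  if (z.2 < 0) || (z.2 == 0) && (z.1 < 0) then (- z.1, - z.2) else z.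

Lemma normalizeE z : normalize z = z \/ normalize z = (- z.1, - z.2).
Proof. by rewrite /normalize; case: ifP; [right|left]. Qed.

Lemma normalize_inj z t :
  normalize z = normalize t -> z = t \/ z = (- t.1, - t.2).
Proof.
case: z t => [a b] [c d].
case: (normalizeE (a, b)) (normalizeE (c, d)) => -> [] -> /= [].
- by move=> -> ->; left.
- by move=> -> ->; right.
- by move=> <- <-; right; rewrite !opprK.
- by move=> /oppr_inj -> /oppr_inj ->; left.
Qed.

Lemma norm_det2_normalize z t : `|det2 (normalize z) (normalize t)| = `|det2 z t|.
Proof.
case: z t => [a b] [c d].
case: (normalizeE (a, b)) (normalizeE (c, d)) => -> [] -> //=;
  rewrite /det2 /= ?mulrNN //.
- by rewrite -normrN; congr `|_|; ring.
- by rewrite -normrN; congr `|_|; ring.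
Qed.

Lemma normalize_level0 z : coprimez z.1 z.2 ->
  (normalize z).2 = 0 -> (normalize z).1 = 1.
Proof.
case: z => a b; rewrite /normalize /=; case: ifP => /= H cab b0.
  have {}b0 : b = 0 by lia.
  by move: cab H; rewrite b0 /coprimez gcdz0; lia.
by move: cab H; rewrite b0 /coprimez gcdz0; lia.
Qed.

(* If [u], [v] have the largest determinant, every vector of [V] is a combination
   of [u] and [v] with coefficients in [[-1, 1]], so a linear form that is small
   at [u] and [v] is small on all of [V]; it becomes the second coordinate. *)
Lemma reduce_slopes (k : nat) (V : seq (int * int)) :
    uniq V ->
    (forall v, v \in V -> coprimez v.1 v.2) ->
    (forall u v, u \in V -> v \in V -> u <> (- v.1, - v.2)) ->
    (forall u v, u \in V -> v \in V -> `|det2 u v| <= k%:Z) ->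
  exists h (W : seq (int * int)), [/\ (h ^ 2 <= 4 * k)%N, size W = size V,
    uniq W, forall v, v \in W -> coprimez v.1 v.2 &
    [/\ forall v, v \in W -> 0 <= v.2 <= h%:Z,
       forall v, v \in W -> v.2 = 0 -> v.1 = 1 &
       forall u v, u \in W -> v \in W -> `|det2 u v| <= k%:Z]].
Proof.
move=> uV cV nV kV.
have [-> |u0V] : V = [::] \/ exists u, u \in V.
- by case: (V) => [|u V']; [left|right; exists u; rewrite mem_head].
- by exists 0%N, [::]; split => //; split.
case: u0V => u0 u0V.
have [u [v [uV' vV Dmax]]] : exists u v, [/\ u \in V, v \in V &
    forall x y, x \in V -> y \in V -> (`|det2 x y| <= `|det2 u v|)%N].
  pose P n := has (fun x => has (fun y => `|det2 x y|%N == n) V) V.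
  have P0 : exists n, P n.
    exists `|det2 u0 u0|%N; apply/hasP; exists u0 => //.
    by apply/hasP; exists u0.
  have Pk n : P n -> (n <= k)%N.
    by move=> /hasP[x xV /hasP[y yV /eqP <-]]; have := kV x y xV yV; lia.
  case: (ex_maxnP P0 Pk) => n /hasP[x xV /hasP[y yV /eqP nE]] nmax.
  exists x, y; split => // x' y' x'V y'V; rewrite nE; apply: nmax.
  by apply/hasP; exists x' => //; apply/hasP; exists y'.
set D := `|det2 u v|%N in Dmax.
(* If all determinants vanish, [V] is a single vector, and [(1, 0)] can replace it. *)
have [D0|Dpos] := posnP D.
  have all_eq x : x \in V -> x = u0.
    move=> xV; have := Dmax _ _ xV u0V; rewrite D0 leqn0 absz_eq0 => /eqP.
    by case/(coprime_det2_eq0 (cV _ xV) (cV _ u0V)) => // /nV; case.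
  have sV : V = [:: u0].
    case: (V) uV all_eq u0V => // x [|y W] /=.
      by move=> _ H _; rewrite (H x) ?mem_head.
    rewrite inE negb_or => /andP[/andP[/eqP xy _] _] H; case: xy.
    by rewrite (H x) ?mem_head // (H y) // inE mem_head orbT.
  exists 0%N, [:: (1, 0)]; rewrite sV; split => //.
    by move=> w; rewrite inE => /eqP ->; rewrite /coprimez gcdz0.
  split=> [w|w|x y]; rewrite !inE => /eqP -> // /eqP ->.
  by rewrite /det2 /= mulr0 mul0r subrr normr0.
have [m /andP[mD Dm]] := sqrtn_exists D.
have absD : `|det2 u v| = D%:Z by rewrite /D abszE.
have [p [q [pq pu pv]]] := small_form (cV _ uV') absD Dpos Dm.
(* Division by the gcd makes the form primitive without enlarging its values; it is then the second
   coordinate of a unimodular map [f]. *)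
pose g := gcdz p q.
have g0 : 0 < g by rewrite lt_def gcdz_eq0 negb_and pq.
pose p' := (p %/ g)%Z; pose q' := (q %/ g)%Z.
have pE : p = p' * g by rewrite divzK // dvdz_gcdl.
have qE : q = q' * g by rewrite divzK // dvdz_gcdr.
have [[r' s'] /= rs] : exists uv : int * int, uv.1 * p' + uv.2 * q' = 1.
  have [a [b abE]] := Bezoutz p q; exists (a, b) => /=.
  apply: (@mulIf _ g); first by rewrite gt_eqF.
  by rewrite mul1r -[RHS]/(gcdz p q) -abE [in RHS]pE [in RHS]qE; ring.
pose f (w : int * int) := (s' * w.1 - r' * w.2, p' * w.1 + q' * w.2).
have f1 w : w.1 = q' * (f w).1 + r' * (f w).2.
  by rewrite -[LHS]mul1r -rs /f /=; ring.
have f2 w : w.2 = - p' * (f w).1 + s' * (f w).2.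
  by rewrite -[LHS]mul1r -rs /f /=; ring.
have fdet x y : det2 (f x) (f y) = det2 x y.
  by rewrite -[RHS]mul1r -rs /det2 /f /=; ring.
have small x : `|p * x.1 + q * x.2| <= m%:Z -> `|(f x).2| <= m%:Z.
  rewrite pE qE => H; apply: le_trans H.
  have -> : p' * g * x.1 + q' * g * x.2 = g * (f x).2 by rewrite /f /=; ring.
  rewrite normrM ler_peMl // gtr0_norm //; lia.
have fh w : w \in V -> `|(f w).2| <= (2 * m)%N%:Z.
  move=> wV; have H1 := Dmax _ _ wV vV; have H2 := Dmax _ _ uV' wV.
  have E : det2 u v * (f w).2 = det2 w v * (f u).2 + det2 u w * (f v).2.
    by rewrite /det2 /f /=; ring.
  have /(congr1 Num.norm) := E; rewrite normrM absD => E'.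
  have : D%:Z * `|(f w).2| <= D%:Z * m%:Z + D%:Z * m%:Z.
    rewrite E'; apply: (le_trans (ler_normD _ _)); rewrite !normrM; apply: lerD.
      by apply: ler_pM => //; exact: small.
    by apply: ler_pM => //; exact: small.
  rewrite -mulrDr ler_pM2l; last by rewrite ltz_nat.
  by rewrite mul2n -addnn PoszD.
pose finv (z : int * int) := (q' * z.1 + r' * z.2, - p' * z.1 + s' * z.2).
have fK : cancel f finv.
  by move=> w; rewrite /finv -f1 -f2 -surjective_pairing.
have fI := can_inj fK.
have fcop w : w \in V -> coprimez (f w).1 (f w).2.
  move=> /cV/coprimezP[[a b] ab]; apply/coprimezP.
  move: ab; rewrite (f1 w) (f2 w); move: (f w) => z ab.
  by exists (a * q' - b * p', a * r' + b * s'); rewrite -ab /=; ring.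
exists (2 * m)%N, [seq normalize (f w) | w <- V]; split.
- rewrite expnMn leq_mul2l /=; apply: (leq_trans mD).
  by have := kV _ _ uV' vV; rewrite absD lez_nat.
- by rewrite size_map.
- rewrite map_inj_in_uniq // => x y xV yV nxy.
  have [fxy|fxy] := normalize_inj nxy.
  + exact: fI.
  + case: (nV x y xV yV); rewrite -(fK x) fxy (f1 y) (f2 y) /finv; move: (f y) => z /=.
    by congr (_, _); ring.
- move=> _ /mapP[w wV ->]; have := fcop w wV.
  by case: (normalizeE (f w)) => -> //=; rewrite coprimezN coprimeNz.
split.
- move=> _ /mapP[w wV ->]; have := fh w wV; rewrite /normalize.
  by case: (f w) => a b /=; case: ifP => /=; clear; lia.
- by move=> _ /mapP[w wV ->]; exact: normalize_level0 (fcop w wV).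
- move=> _ _ /mapP[x xV ->] /mapP[y yV ->].
  by rewrite norm_det2_normalize fdet; exact: kV.
Qed.

(** * Harmonic sums and the arithmetic bound *)

Lemma harmonic_sum_le (R : realType) (n : nat) :
  \sum_(1 <= d < n.+2) d%:R^-1 <= 1 + ln n.+1%:R :> R.
Proof.
elim: n => [|n IH]; first by rewrite big_nat1 ln1 invr1 addr0.
rewrite big_nat_recr //=; apply: le_trans (lerD IH (lexx _)) _.
rewrite -addrA lerD2l -lerBrDl.
have n1 : (0 : R) < n.+1%:R by rewrite ltr0n.
have n2 : (0 : R) < n.+2%:R by rewrite ltr0n.
rewrite -lerN2 opprB -ln_div ?posrE //.
have -> : n.+1%:R / n.+2%:R = 1 + - n.+2%:R^-1 :> R.
  by rewrite -[n.+1%:R](addrK 1) natr1 mulrBl divff ?gt_eqF // mul1r.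
apply: le_ln1Dx; rewrite ltrN2 invf_lt1 // ltr1n //.
Qed.

(** With divisors in place of [2 ^ omega j], exchanging the sums leaves at most [h / d] multiples of
    each [d], hence a harmonic sum. *)
Lemma sum_exp2_primes_le (R : realType) (h : nat) :
  \sum_(1 <= j < h.+1) (2 ^ size (primes j))%:R <= h%:R * (1 + ln h%:R) :> R.
Proof.
case: h => [|h]; first by rewrite big_geq // mul0r.
apply: (@le_trans _ _ (\sum_(1 <= j < h.+2) \sum_(1 <= d < h.+2) (d %| j)%:R)).
  apply: ler_sum_nat => j j1; rewrite -natr_sum ler_nat; exact: exp2_primes_le.
rewrite exchange_big_nat /=.
apply: le_trans (ler_wpM2l (ler0n R h.+1) (harmonic_sum_le R h)).
rewrite mulr_sumr; apply: ler_sum_nat => d /andP[d1 _].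
rewrite -natr_sum sum_dvdn // ler_pdivlMr ?ltr0n // -natrM ler_nat.
exact: leq_divM.
Qed.

Lemma slopes_bound (R : realType) : exists C : R, 0 < C /\
  forall (k : nat) (V : seq (int * int)), (2 <= k)%N ->
    uniq V ->
    (forall v, v \in V -> coprimez v.1 v.2) ->
    (forall u v, u \in V -> v \in V -> u <> (- v.1, - v.2)) ->
    (forall u v, u \in V -> v \in V -> `|det2 u v| <= k%:Z) ->
  (size V)%:R <= k%:R + C * Num.sqrt k%:R * ln k%:R.
Proof.
have l2 : (0 : R) < ln 2 by rewrite ln_gt0 // ltr1n.
pose c : R := (ln 2)^-1.
have c0 : 0 < c by rewrite invr_gt0.
(* Write [s] for the root and [L] for the logarithm of [k]. The first [c] absorbs the constant 1, as
   [c * L >= 1] and [s >= 1]; [6 * (c + 2)] comes from [3 * h * (1 + ln h)] with [h <= 2 * s],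
   [1 <= c * L] and [ln h <= 2 * L]. *)
exists (c + 6 * (c + 2)); split; first by lra.
move=> k V k2 uV cV nV kV.
have [h [W [hk <- uW cW [Wh W0 Wk]]]] := reduce_slopes uV cV nV kV.
apply: le_trans (size_rows_le R uW cW Wh W0 Wk) _.
have := sum_exp2_primes_le R h; set S := \sum_(_ <= _ < _) _ => HS.
have k0 : (0 : R) < k%:R by rewrite ltr0n; lia.
pose s : R := Num.sqrt k%:R; pose L : R := ln k%:R.
have s1 : 1 <= s by rewrite -sqrtr1 ler_wsqrtr // ler1n; lia.
have ss : s * s = k%:R by rewrite -expr2 sqr_sqrtr // ltW.
have Lge : ln 2 <= L by rewrite ler_ln ?posrE // ler_nat.
have cL : 1 <= c * L by rewrite mulrC ler_pdivlMr // mul1r.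
have L0 : 0 < L by lra.
have hs : h%:R <= 2 * s.
  rewrite -(@ler_pXn2r _ 2) ?nnegrE ?mulr_ge0 ?sqrtr_ge0 //.
  by rewrite exprMn -natrX expr2 -natrM [s ^+ 2]expr2 ss -natrM ler_nat.
have lh : h%:R * (1 + ln h%:R) <= 2 * s * ((c + 2) * L).
  have [->|hpos] := posnP h.
    by rewrite mul0r !mulr_ge0 //; lra.
  have lnh : ln h%:R <= 2 * L.
    have h1 : ln h%:R <= ln (2 * k%:R) :> R.
      rewrite ler_ln ?posrE ?ltr0n // ?mulr_gt0 //; apply: (le_trans hs).
      by rewrite ler_pM2l // -ss ler_peMl //; lra.
    by rewrite lnM ?posrE // -/L in h1; lra.
  have ln0 : 0 <= ln h%:R :> R by rewrite ln_ge0 // ler1n.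
  by apply: ler_pM => //; lra.
have s0 : 0 <= s * L by rewrite mulr_ge0 //; lra.
have : 1 <= s * (c * L) by rewrite mulr_ege1.
rewrite -/s -/L; lra.
Qed.

(** * Lifting through the quotient by the integers *)

Local Open Scope classical_set_scope.
Local Open Scope ring_scope.

Section ContinuousModZ.
Variable R : realType.

Definition near_int (e z : R) : Prop := exists n : int, `|z - n%:~R| < e.

(** Continuity of [rho] as a map to R/Z; it suits coordinates of chosen representatives, which may
    jump by integers. *)
Definition contZ (T : topologicalType) (rho : T -> R) : Prop :=
  forall x e, 0 < e -> \forall y \near x, near_int e (rho y - rho x).

Lemma near_intN e z : near_int e z -> near_int e (- z).
Proof.
move=> [n h]; exists (- n); rewrite rmorphN /= -normrN.
by rewrite (_ : - (- z - - n%:~R) = z - n%:~R) //; ring.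
Qed.

Lemma near_intD d e z t : near_int d z -> near_int e t -> near_int (d + e) (z + t).
Proof.
move=> [n h] [m k]; exists (n + m); rewrite rmorphD /=.
rewrite (_ : _ - _ = (z - n%:~R) + (t - m%:~R)); last by ring.
by apply: le_lt_trans (ler_normD _ _) _; exact: ltrD.
Qed.

Lemma contZ_comp (S T : topologicalType) (g : S -> T) (rho : T -> R) :
  continuous g -> contZ rho -> contZ (rho \o g).
Proof. by move=> cg cr x e e0; exact: (cg x _ (cr (g x) e e0)). Qed.

Lemma contZB (T : topologicalType) (rho sigma : T -> R) :
  contZ rho -> contZ sigma -> contZ (fun x => rho x - sigma x).
Proof.
move=> cr cs x e e0; have e2 : 0 < e / 2 by lra.
near=> y; have h1 : near_int (e / 2) (rho y - rho x) by near: y; exact: cr.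
have h2 : near_int (e / 2) (sigma y - sigma x) by near: y; exact: cs.
rewrite (_ : _ - _ = (rho y - rho x) + - (sigma y - sigma x)); last by ring.
rewrite (splitr e); exact: near_intD h1 (near_intN h2).
Unshelve. all: by end_near. Qed.

(** The representative modulo 1 nearest to 0; half-integers go to -1/2. *)
Definition cfrac (z : R) : R := z - (Num.floor (z + 2^-1))%:~R.

Lemma cfrac_int z : exists n : int, cfrac z = z - n%:~R.
Proof. by exists (Num.floor (z + 2^-1)). Qed.

Lemma norm_int_lt1 (n : int) : `|n%:~R : R| < 1 -> n = 0.
Proof. rewrite -intr_norm -[1]/(1%:~R) ltr_int; lia. Qed.

Lemma cfrac_small z e : e <= 2^-1 -> near_int e z -> `|cfrac z| < e.
Proof.
move=> e2 [n h]; rewrite /cfrac; have := floor_itv (z + 2^-1).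
set m := Num.floor _; rewrite intrD => /andP[h1 h2].
suff -> : m = n by [].
apply/eqP; rewrite eq_le -!ltzD1.
move: h; rewrite ltr_norml => /andP[h3 h4].
by apply/andP; split; rewrite -(ltr_int R) intrD; lra.
Qed.

(** [cfrac] jumps only at half-integers, and [sigma] keeps within 1/4 of the integers. *)
Lemma cfrac_continuous (T : topologicalType) (sigma : T -> R) :
  contZ sigma -> (forall x, near_int 4^-1 (sigma x)) -> continuous (cfrac \o sigma).
Proof.
move=> cs ss x; apply/cvgrPdist_lt => e e0.
have m0 : 0 < Num.min e 2^-1 by rewrite lt_min e0; lra.
near=> y.
have [n nh] : near_int (Num.min e 2^-1) (sigma y - sigma x) by near: y; exact: cs.
have /= := cfrac_small _ (ss x); have /= := cfrac_small _ (ss y).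
have [a ->] := cfrac_int (sigma x); have [b ->] := cfrac_int (sigma y).
have q : 4^-1 <= 2^-1 :> R by lra.
move=> /(_ q) h1 /(_ q) h2; move: nh; rewrite lt_min => /andP[h3 h4].
(* An integer of size below 1/4 + 1/4 + 1/2. *)
have : n + a - b = 0.
  apply: norm_int_lt1; rewrite rmorphB rmorphD /=.
  by move: h1 h2 h4; rewrite !ltr_norml; lra.
move=> /(congr1 (fun k : int => k%:~R : R)); rewrite rmorphB rmorphD /= => E.
rewrite distrC (_ : _ - _ = sigma y - sigma x - n%:~R) //.
move: E; set p := n%:~R; set q1 := a%:~R; set r := b%:~R; rewrite mulr0z; lra.
Unshelve. all: by end_near. Qed.

(** The retraction of the line onto [[0, 1]], written with absolute values so that continuity is
    immediate. *)
Definition clamp (x : R) : R := (1 + `|x| - `|x - 1|) / 2.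

Lemma clamp_cont : continuous clamp.
Proof.
move=> x; apply: cvgMl; apply: cvgB; last first.
  by apply: cvg_norm; apply: cvgB; [exact: cvg_id|exact: cvg_cst].
by apply: cvgD; [exact: cvg_cst|apply: cvg_norm; exact: cvg_id].
Qed.

Lemma clamp_id x : 0 <= x <= 1 -> clamp x = x.
Proof.
move=> /andP[x0 x1]; rewrite /clamp ger0_norm // ler0_norm; last by lra.
by field.
Qed.

Lemma clamp_itv x : 0 <= clamp x <= 1.
Proof.
by rewrite /clamp; case: (ger0P x) => h; case: (ger0P (x - 1)) => h'; apply/andP; split; lra.
Qed.

Lemma clamp_le0 x : x <= 0 -> clamp x = 0.
Proof. by move=> x0; rewrite /clamp !ler0_norm; lra. Qed.

Lemma clamp_ge1 x : 1 <= x -> clamp x = 1.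
Proof. by move=> x0; rewrite /clamp !ger0_norm; lra. Qed.

Lemma pair_continuous (T U V : topologicalType) (f : T -> U) (g : T -> V) :
  continuous f -> continuous g -> continuous (fun x => (f x, g x)).
Proof. by move=> cf cg x; apply: cvg_pair; [exact: cf|exact: cg]. Qed.

Lemma comp_continuous (S T U : topologicalType) (f : S -> T) (g : T -> U) :
  continuous f -> continuous g -> continuous (g \o f).
Proof. by move=> cf cg x; exact: continuous_comp (cf x) (cg _). Qed.

Lemma fst_continuous (S T : topologicalType) : continuous (@fst S T).
Proof. by move=> x; exact: cvg_fst. Qed.

Lemma snd_continuous (S T : topologicalType) : continuous (@snd S T).
Proof. by move=> x; exact: cvg_snd. Qed.

Definition clamp2 (p : R * R) : R * R := (clamp p.1, clamp p.2).

Lemma clamp2_cont : continuous clamp2.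
Proof.
apply: pair_continuous.
  exact: (comp_continuous (f := @fst R R) (@fst_continuous R R) clamp_cont).
exact: (comp_continuous (f := @snd R R) (@snd_continuous R R) clamp_cont).
Qed.

Definition in_square (p : R * R) : Prop := 0 <= p.1 <= 1 /\ 0 <= p.2 <= 1.

Lemma clamp2_id p : in_square p -> clamp2 p = p.
Proof. by case: p => a b [/= h1 h2]; rewrite /clamp2 /= !clamp_id. Qed.

Lemma clamp2_square p : in_square (clamp2 p).
Proof. by split; exact: clamp_itv. Qed.

(** The Heine-Cantor argument modulo 1, with compactness of the square in its near-covering form. *)
Lemma contZ_uniform (rho : R * R -> R) (e : R) : contZ rho -> 0 < e ->
  exists2 d : R, 0 < d & forall p q, in_square p -> `|p.1 - q.1| < d -> `|p.2 - q.2| < d ->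
    near_int e (rho q - rho p).
Proof.
move=> cr e0; have e2 : 0 < e / 2 by lra.
pose P (d : R) (p : R * R) := forall q, `|p.1 - q.1| < d -> `|p.2 - q.2| < d ->
  near_int e (rho q - rho p).
have cK : compact (`[0 : R, 1] `*` `[0 : R, 1]) by apply: compact_setX; exact: segment_compact.
have cover p : (`[0 : R, 1] `*` `[0 : R, 1]) p -> \forall p' \near p & d \near 0^'+, P d p'.
  move=> _; have /nbhs_ballP[r /= r0 hr] := cr p (e / 2) e2.
  have r2 : 0 < r / 2 by lra.
  near=> p' d => q /= h1 h2.
  have [b1 b2] : ball p (r / 2) p' by near: p'; exact: nbhsx_ballx.
  have dr : d < r / 2 by near: d; exact: nbhs_right_lt.
  rewrite (_ : rho q - rho p' = (rho q - rho p) + - (rho p' - rho p)); last by ring.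
  rewrite (splitr e); apply: near_intD; last apply: near_intN; apply: hr.
    split; rewrite /ball /= in b1 b2 *.
      rewrite (_ : _ - _ = (p.1 - p'.1) + (p'.1 - q.1)); last by ring.
      by apply: le_lt_trans (ler_normD _ _) _; lra.
    rewrite (_ : _ - _ = (p.2 - p'.2) + (p'.2 - q.2)); last by ring.
    by apply: le_lt_trans (ler_normD _ _) _; lra.
  by split; rewrite /ball /= in b1 b2 *; lra.
have H := iffLR (compact_near_coveringP _) cK R (0^'+) P (at_right_proper_filter _) cover.
have [d [d0 hd]] := filter_ex (filterI (nbhs_right_gt (0 : R)) H).
exists d => // p q [p1 p2]; apply: hd; split; rewrite /= in_itv //.
Unshelve. all: by end_near. Qed.

(* The lift telescopes along the ray from the origin: consecutive points
   [i / N * p] are so close that the increments of [rho] have canonical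
   small representatives modulo the integers. *)
Lemma lift_square (rho : R * R -> R) : contZ rho ->
  exists2 L : R * R -> R, continuous L &
    forall p, in_square p -> exists n : int, L p = rho p + n%:~R.
Proof.
move=> cr; have q0 : 0 < 4^-1 :> R by lra.
have [d d0 hd] := contZ_uniform cr q0.
have [N hN] : exists N : nat, d^-1 < N.+1%:R.
  by exists (Num.truncn d^-1); exact: truncnS_gt.
have N0 : (0 : R) < N.+1%:R by rewrite ltr0n.
(* Clamping lets one formula define a continuous [L] on the whole plane. *)
pose pt (i : nat) (p : R * R) : R * R :=
  (i%:R / N.+1%:R * clamp p.1, i%:R / N.+1%:R * clamp p.2).
pose inc (i : nat) (p : R * R) := rho (pt i.+1 p) - rho (pt i p).
have pt_cont i : continuous (pt i).
  apply: pair_continuous => p; apply: cvgMr.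
    exact: (comp_continuous (f := @fst R R) (@fst_continuous R R) clamp_cont).
  exact: (comp_continuous (f := @snd R R) (@snd_continuous R R) clamp_cont).
have inc_small i p : (i < N.+1)%N -> near_int 4^-1 (inc i p).
  move=> iN; have i1 : i%:R / N.+1%:R <= 1 :> R.
    by rewrite ler_pdivrMr // mul1r ler_nat ltnW.
  have i0 : 0 <= i%:R / N.+1%:R :> R by rewrite divr_ge0.
  have step (x : R) : 0 <= x <= 1 -> `|i%:R / N.+1%:R * x - i.+1%:R / N.+1%:R * x| < d.
    move=> /andP[x0 x1]; rewrite distrC -mulrBl -mulrBl -natr1 [i%:R + 1]addrC addrK mul1r.
    rewrite ger0_norm ?mulr_ge0 ?invr_ge0 //; apply: (@le_lt_trans _ _ (N.+1%:R^-1)).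
      by rewrite ler_piMr // invr_ge0.
    by rewrite invf_plt ?posrE.
  have sq (x : R) : 0 <= x <= 1 -> 0 <= i%:R / N.+1%:R * x <= 1.
    by move=> /andP[x0 x1]; rewrite (mulr_ge0 i0 x0) mulr_ile1.
  apply: hd.
  - split; apply: sq; exact: clamp_itv.
  - apply: step; exact: clamp_itv. 
  - apply: step; exact: clamp_itv.
exists (fun p => rho (0, 0) + \sum_(i < N.+1) cfrac (inc i p)).
  move=> p; apply: cvgD; first exact: cvg_cst.
  apply: cvg_big => [|i _]; first exact: add_continuous.
  apply: (@cfrac_continuous _ (inc i)).
    by apply: contZB; apply: contZ_comp.
  by move=> q; exact: inc_small.
move=> p psq.
have partial n : exists m : int, rho (0, 0) + \sum_(i < n) cfrac (inc i p) = rho (pt n p) + m%:~R.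
  elim: n => [|n [m IH]].
    by exists 0; rewrite big_ord0 /pt !mul0r.
  have [k kE] := cfrac_int (inc n p); exists (m - k).
  by rewrite big_ord_recr /= addrA IH kE /inc rmorphB /=; ring.
have [m ->] := partial N.+1; exists m; congr (rho _ + _).
by rewrite /pt divff ?gt_eqF // !mul1r -[RHS](clamp2_id psq).
Qed.

End ContinuousModZ.

(** * The Poincare-Miranda theorem in the plane *)

Section PoincareMiranda.
Variable R : realType.

Definition half_angle (z : R * R) : R := (1 - z.1 / (`|z.1| + `|z.2|)) / 4.

(* The argument of [z] in turns, for the norm [|x| + |y|]; it jumps by an
   integer across the negative half-line. *)
Definition angle (z : R * R) : R := if 0 <= z.2 then half_angle z else - half_angle z.

Lemma norm1_gt0 (z : R * R) : z != (0, 0) -> 0 < `|z.1| + `|z.2|.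
Proof.
case: z => x y /= z0; rewrite lt_def addr_ge0 // andbT paddr_eq0 // !normr_eq0.
by apply: contraNN z0 => /andP[/eqP -> /eqP ->].
Qed.

Lemma half_angle_itv (z : R * R) : z != (0, 0) -> 0 <= half_angle z <= 2^-1.
Proof.
move=> /norm1_gt0 r0; rewrite /half_angle.
have : z.1 / (`|z.1| + `|z.2|) <= 1.
  by rewrite ler_pdivrMr // mul1r; have := ler_norm z.1; have := normr_ge0 z.2; lra.
have : -1 <= z.1 / (`|z.1| + `|z.2|).
  rewrite ler_pdivlMr // mulN1r; have := ler_norm (- z.1).
  by rewrite normrN; have := normr_ge0 z.2; lra.
by move=> h1 h2; apply/andP; split; lra.
Qed.

Lemma half_angle_cont (z : R * R) : z != (0, 0) -> half_angle w @[w --> z] --> half_angle z.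
Proof.
move=> /norm1_gt0 r0; apply: cvgMl; apply: cvgB; first exact: cvg_cst.
apply: cvgM; first exact: cvg_fst.
apply: cvgV; first by rewrite gt_eqF.
by apply: cvgD; apply: cvg_norm; [exact: cvg_fst|exact: cvg_snd].
Qed.

(** Off the horizontal axis [angle] is locally [half_angle] up to a fixed sign. On the axis
    [half_angle] is 0 or 1/2, so a change of sign costs an integer. *)
Lemma angle_contZ (z : R * R) (e : R) : z != (0, 0) -> 0 < e ->
  \forall w \near z, near_int e (angle w - angle z).
Proof.
move=> z0 e0; have ha := half_angle_cont z0.
have hn : \forall w \near z, `|half_angle z - half_angle w| < e.
  by move/cvgrPdist_lt : ha; apply.
have c2 : w.2 @[w --> z] --> z.2 by exact: cvg_snd.
have [y0|y0|y0] := ltgtP z.2 0.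
- near=> w; exists 0; rewrite mulr0z subr0 /angle.
  have w2 : w.2 < 0 by near: w; apply: (c2 (fun y => y < 0)); exact: lt_nbhsl.
  rewrite (lt_geF y0) (lt_geF w2) opprK addrC; near: w; exact: hn.
- near=> w; exists 0; rewrite mulr0z subr0 /angle.
  have w2 : 0 < w.2 by near: w; apply: (c2 (fun y => 0 < y)); exact: lt_nbhsr.
  rewrite (ltW y0) (ltW w2) distrC; near: w; exact: hn.
- near=> w; have : `|half_angle z - half_angle w| < e by near: w; exact: hn.
  rewrite /angle y0 lexx.
  have [x0|x0] : half_angle z = 0 \/ half_angle z = 2^-1.
    have := norm1_gt0 z0; rewrite /half_angle y0 normr0 addr0.
    case: (ger0P z.1) => x0 h; first by left; rewrite divff ?gt_eqF // subrr mul0r.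
    by right; rewrite invrN mulrN divff ?lt_eqF //; lra.
  + rewrite x0 sub0r normrN => h; exists 0; rewrite mulr0z !subr0.
    by case: ifP => _; rewrite ?normrN.
  + rewrite x0 => h; case: ifP => _; first by exists 0; rewrite mulr0z subr0 distrC.
    exists (-1); rewrite (_ : _ - _ = 2^-1 - half_angle w) // mulrN1z; lra.
Unshelve. all: by end_near. Qed.

Lemma angle_left (z : R * R) : z.1 < 0 -> 4^-1 < `|angle z| <= 2^-1.
Proof.
move=> x0; have z0 : z != (0, 0).
  by apply: contraTneq x0 => ->; rewrite ltxx.
have /andP[h0 h2] := half_angle_itv z0.
have -> : `|angle z| = half_angle z.
  by rewrite /angle; case: ifP => _; rewrite ?normrN ger0_norm.
rewrite h2 andbT /half_angle; have := norm1_gt0 z0 => r0.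
suff : z.1 / (`|z.1| + `|z.2|) < 0 by lra.
by rewrite pmulr_llt0 // invr_gt0.
Qed.

Lemma angle_right (z : R * R) : 0 < z.1 -> `|angle z| < 4^-1.
Proof.
move=> x0; have z0 : z != (0, 0).
  by apply: contraTneq x0 => ->; rewrite ltxx.
have /andP[h0 h2] := half_angle_itv z0.
have -> : `|angle z| = half_angle z.
  by rewrite /angle; case: ifP => _; rewrite ?normrN ger0_norm.
rewrite /half_angle; have := norm1_gt0 z0 => r0.
suff : 0 < z.1 / (`|z.1| + `|z.2|) by lra.
by rewrite divr_gt0.
Qed.

Lemma angle_top (z : R * R) : z != (0, 0) -> 0 <= z.2 -> 0 <= angle z <= 2^-1.
Proof. by move=> z0 y0; rewrite /angle y0; exact: half_angle_itv. Qed.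

Lemma angle_bottom (z : R * R) : z != (0, 0) -> z.2 <= 0 ->
  - 2^-1 <= angle z <= 0 \/ angle z = 2^-1.
Proof.
move=> z0 y0; have /andP[h0 h2] := half_angle_itv z0; rewrite /angle.
case: ifP => h; last by left; apply/andP; split; lra.
have y00 : z.2 = 0 by apply: le_anti; rewrite y0 h.
have := norm1_gt0 z0; rewrite /half_angle y00 normr0 addr0.
case: (ger0P z.1) => x0 r0.
  by left; rewrite divff ?gt_eqF // subrr mul0r; apply/andP; split; lra.
by right; rewrite invrN mulrN divff ?lt_eqF //; lra.
Qed.

Lemma eq_int_of_dist (n m : int) : `|n%:~R - m%:~R : R| < 1 -> n = m.
Proof. by rewrite -rmorphB /= => /norm_int_lt1 /eqP; rewrite subr_eq0 => /eqP. Qed.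

(** A number [th] other than [c] at distance below 1 from it is not congruent to [c] modulo 1. So
    [phi] avoids the translates of [c] by integers, and by the intermediate value theorem it stays
    between two consecutive ones. *)
Lemma gap_constant (phi : R -> R) (c : R) (n : int) : continuous phi ->
    (forall t, 0 <= t <= 1 -> exists th, exists m : int,
       [/\ phi t = th + m%:~R, `|th - c| < 1 & th != c]) ->
    c + n%:~R < phi 0 < c + n%:~R + 1 -> c + n%:~R < phi 1 /\ phi 1 < c + n%:~R + 1.
Proof.
move=> cphi H /andP[h0 h1].
have avoid t (m : int) : 0 <= t <= 1 -> phi t != c + m%:~R.
  move=> /H[th [k [-> hc tc]]]; apply: contraNneq tc => E.
  have mk : (m - k)%:~R = th - c by rewrite rmorphB /=; lra.
  by move: hc; rewrite -mk => /norm_int_lt1 mk0; rewrite mk0 mulr0z in mk; apply/eqP; lra.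
have ivt v : Num.min (phi 0) (phi 1) <= v <= Num.max (phi 0) (phi 1) ->
    exists2 t, 0 <= t <= 1 & phi t = v.
  by move=> /(IVT ler01 (continuous_subspaceT cphi))[t]; rewrite in_itv /= => ? ?; exists t.
split; rewrite ltNge; apply/negP => h.
  have [|t t01 E] := ivt (c + n%:~R).
    by rewrite ge_min le_max h (ltW h0) orbT.
  by have := avoid t n t01; rewrite E eqxx.
have [|t t01 E] := ivt (c + n%:~R + 1).
  by rewrite ge_min le_max h (ltW h1) orbT.
by have := avoid t (n + 1) t01; rewrite rmorphD /= E addrA eqxx.
Qed.

(* Without a zero, the argument of [h] would lift to the square, while it makes
   one full turn along the boundary. *)
Lemma poincare_miranda (h : R * R -> R * R) : continuous h ->
    (forall t : R, 0 <= t <= 1 -> [/\ (h (0, t)).1 < 0, 0 < (h (1, t)).1,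
       (h (t, 0)).2 <= 0 & 0 <= (h (t, 1)).2]) ->
  exists2 p, in_square p & h p = (0, 0).
Proof.
move=> ch side; apply: contrapT => noz.
have nz p : in_square p -> h p != (0, 0).
  by move=> psq; apply/eqP => hp; apply: noz; exists p.
have cZ : contZ (angle \o (h \o @clamp2 R)).
  move=> p e e0; have hp := nz _ (clamp2_square p).
  have cc : (h \o @clamp2 R) q @[q --> p] --> h (clamp2 p).
    exact: continuous_comp (@clamp2_cont R p) (ch _).
  exact: (cc _ (angle_contZ hp e0)).
have [L cL L0] := lift_square cZ.
have LE p : in_square p -> exists n : int, L p = angle (h p) + n%:~R.
  by move=> psq; have [n] := L0 p psq; rewrite /= clamp2_id //; exists n.
have i0 : 0 <= (0 : R) <= 1 by apply/andP; split; lra.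
have i1 : 0 <= (1 : R) <= 1 by apply/andP; split; lra.
have cv (t : R) : continuous (fun s : R => L (t, s)).
  have c1 : continuous (fun s : R => (t, s)).
    by apply: pair_continuous => x; [exact: cvg_cst|exact: cvg_id].
  by move=> s; exact: continuous_comp (c1 s) (cL _).
have chz (t : R) : continuous (fun s : R => L (s, t)).
  have c1 : continuous (fun s : R => (s, t)).
    by apply: pair_continuous => x; [exact: cvg_id|exact: cvg_cst].
  by move=> s; exact: continuous_comp (c1 s) (cL _).
(* At each corner the quadrant of [h] is known; [n00], [n10], [n11], [n01] are the turn numbers of
   the lift there, for angles taken in [[0, 1]]. *)
have [n00 b00] : exists n : int, 2^-1 <= L (0, 0) - n%:~R < 3 / 4.
  have [n ->] := LE (0, 0) (conj i0 i0); have [l _ b _] := side 0 i0.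
  have /andP[] := angle_left l; have := angle_bottom (nz (0, 0) (conj i0 i0)) b.
  move=> [/andP[a1 a2]|->].
    by rewrite ler0_norm // => a3 a4; exists (n - 1); rewrite rmorphB /=; apply/andP; split; lra.
  by move=> _ _; exists n; apply/andP; split; lra.
have [n10 b10] : exists n : int, 3 / 4 < L (1, 0) - n%:~R <= 1.
  have [n ->] := LE (1, 0) (conj i1 i0); have [_ r _ _] := side 0 i0; have [_ _ b _] := side 1 i1.
  have := angle_right r; have := angle_bottom (nz (1, 0) (conj i1 i0)) b.
  move=> [/andP[a1 a2]|->].
    by rewrite ler0_norm // => a3; exists (n - 1); rewrite rmorphB /=; apply/andP; split; lra.
  by rewrite ger0_norm; lra.
have [n11 b11] : exists n : int, 0 <= L (1, 1) - n%:~R < 4^-1.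
  have [n ->] := LE (1, 1) (conj i1 i1); have [_ r _ t] := side 1 i1.
  have := angle_right r; have /andP[a1 a2] := angle_top (nz (1, 1) (conj i1 i1)) t.
  by rewrite ger0_norm // => a3; exists n; apply/andP; split; lra.
have [n01 b01] : exists n : int, 4^-1 < L (0, 1) - n%:~R <= 2^-1.
  have [n ->] := LE (0, 1) (conj i0 i1); have [l _ _ _] := side 1 i1; have [_ _ _ t] := side 0 i0.
  have := angle_left l; have /andP[a1 a2] := angle_top (nz (0, 1) (conj i0 i1)) t.
  by rewrite ger0_norm // => /andP[a3 a4]; exists n; apply/andP; split; lra.
have sq (s t : R) : 0 <= s <= 1 -> 0 <= t <= 1 -> in_square (s, t) by [].
(* The angle avoids 0 on the left side, 1/4 on the bottom, 1/2 on the right and -1/4 on the top, so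
   [gap_constant] compares the turn numbers along each side. Only the right side, where the angle
   passes 0, changes them, by 1: a contradiction around the boundary. *)
have left : n01 = n00.
  apply: eq_int_of_dist.
  have [t ti||h1 h2] := @gap_constant (fun t => L (0, t)) 0 n00 (cv 0).
  - have [n LEn] := LE _ (sq 0 t i0 ti); have [l _ _ _] := side t ti.
    exists (angle (h (0, t))), n; have /andP[a1 a2] := angle_left l.
    by rewrite subr0 LEn; split => //; [lra|apply: contraTneq a1 => ->; rewrite normr0; lra].
  - by move/andP: b00 => [? ?]; apply/andP; split; lra.
  - by move/andP: b01 => [? ?]; rewrite ltr_norml; apply/andP; split; lra.
have bottom : n10 = n00.
  apply: eq_int_of_dist.
  have [t ti||h1 h2] := @gap_constant (fun t => L (t, 0)) 4^-1 n00 (chz 0).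
  - have [n LEn] := LE _ (sq t 0 ti i0); have [_ _ b _] := side t ti.
    exists (angle (h (t, 0))), n; rewrite LEn ltr_norml.
    have [/andP[a1 a2]|->] := angle_bottom (nz _ (sq t 0 ti i0)) b.
      by split => //; [apply/andP; split|rewrite lt_eqF //]; lra.
    by split => //; [apply/andP; split|rewrite gt_eqF //]; lra.
  - by move/andP: b00 => [? ?]; apply/andP; split; lra.
  - by move/andP: b10 => [? ?]; rewrite ltr_norml; apply/andP; split; lra.
have right : n11 = n10 + 1.
  apply: eq_int_of_dist; rewrite rmorphD /=.
  have [t ti||h1 h2] := @gap_constant (fun t => L (1, t)) 2^-1 n10 (cv 1).
  - have [n LEn] := LE _ (sq 1 t i1 ti); have [_ r _ _] := side t ti.
    exists (angle (h (1, t))), n; rewrite LEn ltr_norml.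
    have := angle_right r; rewrite ltr_norml => /andP[a1 a2].
    by split => //; [apply/andP; split|rewrite lt_eqF //]; lra.
  - by move/andP: b10 => [? ?]; apply/andP; split; lra.
  - by move/andP: b11 => [? ?]; rewrite ltr_norml; apply/andP; split; lra.
have top : n01 = n11.
  apply: eq_int_of_dist.
  have ctop : continuous (fun t : R => L (1 - t, 1)).
    have c1 : continuous (fun t : R => 1 - t).
      by move=> t; apply: cvgB; [exact: cvg_cst|exact: cvg_id].
    by move=> t; exact: continuous_comp (c1 t) (chz _ _).
  have := @gap_constant (fun t : R => L (1 - t, 1)) (- 4^-1) n11 ctop.
  rewrite subrr subr0 => -[t ti||h1 h2].
  - have ti' : 0 <= 1 - t <= 1 by move/andP: ti => [? ?]; apply/andP; split; lra.
    have [n LEn] := LE _ (sq (1 - t) 1 ti' i1); have [_ _ _ b] := side _ ti'.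
    exists (angle (h (1 - t, 1))), n; rewrite LEn ltr_norml.
    have /andP[a1 a2] := angle_top (nz _ (sq _ 1 ti' i1)) b.
    by split => //; [apply/andP; split|rewrite gt_eqF //]; lra.
  - by move/andP: b11 => [? ?]; apply/andP; split; lra.
  - by move/andP: b01 => [? ?]; rewrite ltr_norml; apply/andP; split; lra.
by move: left bottom right top; clear; lia.
Qed.
End PoincareMiranda.

(** * Curves on the torus and their lifts *)

Local Open Scope quotient_scope.

Section Lifts.
Variable R : realType.
Implicit Types (f g : circle R -> torus R) (F G : R -> R * R) (u v : int * int).

Let zero01 : 0 <= (0 : R) <= 1. Proof. by apply/andP; split; lra. Qed.
Let one01 : 0 <= (1 : R) <= 1. Proof. by apply/andP; split; lra. Qed.

Lemma circle_piP (s t : R) :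
  \pi_(circle R) s = \pi_(circle R) t <-> exists n : int, s = t + n%:~R.
Proof.
split=> [/eqquotP/intrP[n E]|[n E]]; first by exists n; rewrite -E; ring.
by apply/eqquotP/intrP; exists n; rewrite E; ring.
Qed.

Lemma torus_piP (p q : R * R) :
  \pi_(torus R) p = \pi_(torus R) q <->
  exists u, p = (q.1 + u.1%:~R, q.2 + u.2%:~R).
Proof.
case: p q => [a b] [c d]; split=> [/eqquotP/andP[/intrP[n En] /intrP[m Em]]|[[n m] [-> ->]]].
  by exists (n, m); move: En Em => /= <- <-; congr (_, _); ring.
apply/eqquotP/andP; split; apply/intrP; [exists n|exists m] => /=; ring.
Qed.

Lemma repr_torus (p : R * R) : exists u, repr (\pi_(torus R) p) = (p.1 + u.1%:~R, p.2 + u.2%:~R).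
Proof. by apply/torus_piP; rewrite reprK. Qed.

Lemma repr_circle (t : R) : exists n : int, repr (\pi_(circle R) t) = t + n%:~R.
Proof. by apply/circle_piP; rewrite reprK. Qed.

Lemma near_intZ (e z : R) (n : int) : near_int e (z + n%:~R) <-> near_int e z.
Proof.
split=> -[m]; [exists (m - n)|exists (m + n)]; rewrite ?rmorphB ?rmorphD /=.
  by rewrite (_ : _ - _ = z + n%:~R - m%:~R) //; ring.
by rewrite (_ : _ - _ = z - m%:~R) //; ring.
Qed.

Lemma near_int_open (e a : R) : open [set z : R | near_int e (z - a)].
Proof.
rewrite openE => z [n h] /=.
have c : (w - a - n%:~R) @[w --> z] --> z - a - n%:~R.
  by apply: cvgB; [apply: cvgB; [exact: cvg_id|exact: cvg_cst]|exact: cvg_cst].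
have cn : `|w - a - n%:~R| @[w --> z] --> `|z - a - n%:~R| by exact: cvg_norm.
have := cn _ (lt_nbhsl h); rewrite nbhs_filterE /=.
by apply: filterS => w hw; exists n.
Qed.

Definition coord (i : bool) (p : R * R) : R := if i then p.1 else p.2.
Definition icoord (i : bool) (u : int * int) : int := if i then u.1 else u.2.

Lemma coord_cont i : continuous (coord i).
Proof. by case: i => p; [exact: cvg_fst|exact: cvg_snd]. Qed.

Lemma coord_repr i (p : R * R) :
  exists n : int, coord i (repr (\pi_(torus R) p)) = coord i p + n%:~R.
Proof. by have [u ->] := repr_torus p; exists (icoord i u); case: i. Qed.

(** Representatives may jump, but by integers only; a neighbourhood defined modulo 1 is saturated,
    hence open in the quotient. *)
Lemma torus_contZ (T : topologicalType) (h : T -> torus R) i :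
  continuous h -> contZ (fun x => coord i (repr (h x))).
Proof.
move=> ch x e e0; set a := coord i (repr (h x)).
pose V : set (torus R) := [set c | near_int e (coord i (repr c) - a)].
suff : nbhs (h x) V by exact: ch.
apply: open_nbhs_nbhs; split; last by exists 0; rewrite subrr mulr0z subrr normr0.
rewrite /open /= /quotient_open.
have -> : \pi_(torus R) @^-1` V = coord i @^-1` [set z | near_int e (z - a)].
  apply/seteqP; split=> p; rewrite /V /=; have [n ->] := coord_repr i p;
    by rewrite addrAC near_intZ.
by apply: open_comp; [move=> p _; exact: coord_cont|exact: near_int_open].
Qed.

Definition is_lift f F u : Prop :=
  [/\ continuous F, forall t, \pi_(torus R) (F t) = f (\pi_(circle R) t) &
      forall t, F (t + 1) = ((F t).1 + u.1%:~R, (F t).2 + u.2%:~R)].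

(** An instance of [gap_constant] at the half-integers, which [phi] avoids. *)
Lemma int_valued_constant (phi : R -> R) : continuous phi ->
  (forall t, 0 <= t <= 1 -> exists n : int, phi t = n%:~R) -> phi 0 = phi 1.
Proof.
move=> cphi H.
have [n0 E0] := H 0 zero01; have [n1 E1] := H 1 one01.
have [t /H[n En]||] := @gap_constant _ phi 2^-1 (n0 - 1) cphi.
- exists 0, n; rewrite add0r sub0r normrN; split => //; last by rewrite lt_eqF //; lra.
  by rewrite ger0_norm; lra.
- by rewrite E0 rmorphB /=; apply/andP; split; lra.
- rewrite rmorphB /= E0 E1 => h1 h2; congr (_%:~R); apply: (@eq_int_of_dist R).
  by rewrite ltr_norml; apply/andP; split; lra.
Qed.

(** [lift_square] lifts one period as [l]; adding its increment [n] once per period extends the lift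
    to the line. *)
Lemma lift_real (rho : R -> R) : contZ rho ->
    (forall t (k : int), rho (t + k%:~R) = rho t) ->
  exists (F : R -> R) (n : int), [/\ continuous F,
    forall t, exists m : int, F t = rho t + m%:~R & forall t, F (t + 1) = F t + n%:~R].
Proof.
move=> cr per.
have [L cL HL] := @lift_square R (rho \o fst) (contZ_comp (fun p => cvg_fst) cr).
pose l (t : R) := L (clamp t, 0).
have cl : continuous l.
  have c1 : continuous (fun t : R => (clamp t, 0 : R)).
    by apply: pair_continuous => x; [exact: clamp_cont|exact: cvg_cst].
  by move=> t; exact: continuous_comp (c1 t) (cL _).
have lE t : 0 <= t <= 1 -> exists m : int, l t = rho t + m%:~R.
  move=> t01; have [m] := HL (clamp t, 0) (conj (clamp_itv t) zero01).
  by rewrite /l /= clamp_id //; exists m.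
have [n nE] : exists n : int, l 1 - l 0 = n%:~R.
  have [m0 ->] := lE 0 zero01; have [m1 ->] := lE 1 one01.
  by exists (m1 - m0); rewrite -(per 0 1) add0r rmorphB /=; ring.
have l_le0 t : t <= 0 -> l t = l 0 by move=> t0; rewrite /l !clamp_le0.
have l_ge1 t : 1 <= t -> l t = l 1 by move=> t0; rewrite /l !clamp_ge1.
pose fl (t : R) : R := (Num.floor t)%:~R.
have fl_itv t : fl t <= t < fl t + 1 by have := floor_itv t; rewrite intrD.
have frac01 t : 0 <= t - fl t <= 1.
  by move/andP: (fl_itv t) => [? ?]; apply/andP; split; lra.
pose F t := l (t - fl t) + fl t * n%:~R.
have floorE t (k : int) : k%:~R <= t < k%:~R + 1 -> fl t = k%:~R.
  move=> /andP[k1 k2]; rewrite /fl; congr _%:~R; apply: (@eq_int_of_dist R).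
  by move/andP: (fl_itv t); rewrite /fl => -[? ?]; rewrite ltr_norml; apply/andP; split; lra.
exists F, n; split.
- move=> t; set k := Num.floor t.
  (* Near [t] the integer part takes the values [k - 1] and [k]; with the clamped
     lift [l], one continuous formula covers both. *)
  pose G (s : R) := l (s - k%:~R) + k%:~R * n%:~R + (l (s - k%:~R + 1) - l 1).
  have FG s : k%:~R - 1 < s < k%:~R + 1 -> F s = G s.
    move=> /andP[s1 s2]; rewrite /F /G; have [ks|sk] := leP k%:~R s.
      rewrite (floorE s k); last by apply/andP; split.
      by rewrite [l (_ + 1)]l_ge1 ?subrr ?addr0 //; lra.
    rewrite (floorE s (k - 1)); last by rewrite rmorphB /=; apply/andP; split; lra.
    rewrite [l (s - k%:~R)]l_le0; last by lra.
    rewrite rmorphB /= mulrBl mul1r (_ : s - (_ - 1) = s - k%:~R + 1); last by ring.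
    by move: nE; lra.
  have cG : G s @[s --> t] --> G t.
    have sub (c : R) : continuous (fun s : R => s - c).
      by move=> s; apply: cvgB; [exact: cvg_id|exact: cvg_cst].
    have sub1 (c : R) : continuous (fun s : R => s - c + 1).
      by move=> s; apply: cvgD; [exact: sub|exact: cvg_cst].
    apply: cvgD; first by apply: cvgD; [exact: continuous_comp (sub _ _) (cl _)|exact: cvg_cst].
    by apply: cvgB; [exact: continuous_comp (sub1 _ _) (cl _)|exact: cvg_cst].
  have kt : k%:~R - 1 < t < k%:~R + 1.
    by move/andP: (fl_itv t); rewrite /fl -/k => -[? ?]; apply/andP; split; lra.
  rewrite /continuous_at (FG t kt); apply: cvg_trans cG; apply: near_eq_cvg.
  move/andP: kt => [kt1 kt2]; near=> s; apply/esym/FG; apply/andP; split; near: s.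
    exact: lt_nbhsr. exact: lt_nbhsl.
- move=> t; have [m mE] := lE (t - fl t) (frac01 t).
  exists (m + Num.floor t * n); rewrite /F mE /fl rmorphD rmorphM /= addrA.
  by rewrite -rmorphN per.
- move=> t; have flS : fl (t + 1) = fl t + 1.
    rewrite (floorE _ (Num.floor t + 1)); rewrite rmorphD //=.
    by move/andP: (fl_itv t); rewrite /fl => -[? ?]; apply/andP; split; lra.
  by rewrite /F flS (_ : t + 1 - _ = t - fl t); ring.
Unshelve. all: by end_near. Qed.

Lemma lift_exists f : continuous f -> exists F u, is_lift f F u.
Proof.
move=> cf; have cfp : continuous (f \o \pi_(circle R)).
  by move=> t; exact: continuous_comp (@pi_continuous _ _ t) (cf _).
have per i t (k : int) : coord i (repr (f (\pi_(circle R) (t + k%:~R)))) =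
    coord i (repr (f (\pi_(circle R) t))).
  by rewrite (iffRL (circle_piP (t + k%:~R) t)) //; exists k.
have [F1 [n1 [c1 l1 p1]]] := lift_real (torus_contZ true cfp) (per true).
have [F2 [n2 [c2 l2 p2]]] := lift_real (torus_contZ false cfp) (per false).
exists (fun t => (F1 t, F2 t)), (n1, n2); split.
- exact: pair_continuous.
- move=> t; rewrite -[RHS]reprK; apply/torus_piP.
  by have [m ->] := l1 t; have [m' ->] := l2 t; exists (m, m').
- by move=> t; rewrite p1 p2.
Qed.
End Lifts.

(** * Free homotopy and the vector of a lift *)

Section Homotopy.
Variable R : realType.
Implicit Types (f g : circle R -> torus R) (F G : R -> R * R) (u v : int * int).

Let zero01 : 0 <= (0 : R) <= 1. Proof. by apply/andP; split; lra. Qed.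
Let one01 : 0 <= (1 : R) <= 1. Proof. by apply/andP; split; lra. Qed.

Definition oppv u : int * int := (- u.1, - u.2).

Lemma pair_ext u v : (forall i, icoord i u = icoord i v) -> u = v.
Proof. by case: u v => [a b] [c d] H; have /= -> := H true; have /= -> := H false. Qed.

Lemma coordE i F u t : F (t + 1) = ((F t).1 + u.1%:~R, (F t).2 + u.2%:~R) ->
  coord i (F (t + 1)) = coord i (F t) + (icoord i u)%:~R :> R.
Proof. by move=> ->; case: i. Qed.

Lemma lift_repr f F u i t : is_lift f F u ->
  exists n : int, coord i (F t) = coord i (repr (f (\pi_(circle R) t))) + n%:~R.
Proof.
case=> _ /(_ t) <- _; have [n ->] := coord_repr i (F t); exists (- n).
by rewrite rmorphN /=; ring.
Qed.

(** Once the homotopy is lifted to the square, [L (s, 1) - L (s, 0)] is an integer depending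
    continuously on [s], hence constant; at the ends it is a coordinate of [u] and of [v]. *)
Lemma homotopic_lift_eq f g F G u v :
  homotopic f g -> is_lift f F u -> is_lift g G v -> u = v.
Proof.
move=> [H [cH H0 H1]] lF lG; apply: pair_ext => i.
(* [H] is only known to be continuous over [[0, 1]]; clamping extends this to the plane. *)
pose H' (p : R * R) := H (clamp p.1, \pi_(circle R) p.2).
have cg : continuous (fun p : R * R => (clamp p.1, \pi_(circle R) p.2)).
  apply: pair_continuous.
    exact: (comp_continuous (f := @fst R R) (g := @clamp R) (@fst_continuous R R) (@clamp_cont R)).
  exact: (comp_continuous (f := @snd R R) (@snd_continuous R R) (@pi_continuous _ _)).
have cH' : continuous H'.
  move=> p; have Ap q : (`[0 : R, 1] `*` [set: circle R]) (clamp q.1, \pi_(circle R) q.2).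
    by split => //=; rewrite in_itv; exact: clamp_itv.
  move/subspace_continuousP : cH => /(_ _ (Ap p)) cH V hV.
  have VH : nbhs (clamp p.1, \pi_(circle R) p.2)
    (fun q => (`[0 : R, 1] `*` [set: circle R]) q -> V (H q)) by exact: cH V hV.
  have := cg p _ VH; rewrite !nbhs_filterE; apply: (@filterS _ (nbhs p)) => q /= Hq.
  exact: Hq (Ap q).
have [L cL HL] := lift_square (torus_contZ i cH').
have cv (t : R) : continuous (fun s : R => L (t, s)).
  have c1 : continuous (fun s : R => (t, s)).
    by apply: pair_continuous => x; [exact: cvg_cst|exact: cvg_id].
  by move=> s; exact: continuous_comp (c1 s) (cL _).
have ch (t : R) : continuous (fun s : R => L (s, t)).
  have c1 : continuous (fun s : R => (s, t)).
    by apply: pair_continuous => x; [exact: cvg_id|exact: cvg_cst].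
  by move=> s; exact: continuous_comp (c1 s) (cL _).
(* [L (s, _)] and the lift [K] of the same curve differ by a continuous integer-valued function, so
   their increments agree. *)
have end_degree (s : R) h K w : 0 <= s <= 1 ->
    (forall x, H (s, x) = h x) -> is_lift h K w ->
    L (s, 1) - L (s, 0) = (icoord i w)%:~R.
  move=> s01 Hs lK; have [cK _ pK] := lK.
  have := @int_valued_constant R (fun t => L (s, t) - coord i (K t)).
  have cLK : continuous (fun t : R => L (s, t) - coord i (K t)).
    move=> t; apply: cvgB; first exact: cv.
    exact: (comp_continuous cK (@coord_cont R i)).
  move=> /(_ cLK) E; have {}E := E _.
  suff : L (s, 0) - coord i (K 0) = L (s, 1) - coord i (K 1).
    by have := coordE i (pK 0); rewrite add0r; lra.
  apply: E => t t01; have [n ->] := HL (s, t) (conj s01 t01).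
  have [m ->] := lift_repr i t lK; rewrite /H' /= clamp_id // Hs.
  by exists (n - m); rewrite rmorphB /=; ring.
have E0 := end_degree 0 f F u zero01 H0 lF.
have E1 := end_degree 1 g G v one01 H1 lG.
have : L (0, 1) - L (0, 0) = L (1, 1) - L (1, 0).
  apply: (@int_valued_constant R (fun s => L (s, 1) - L (s, 0))).
    by move=> s; apply: cvgB; exact: ch.
  move=> s s01; have [n ->] := HL (s, 1) (conj s01 one01).
  have [m ->] := HL (s, 0) (conj s01 zero01).
  rewrite /H' /= (iffRL (circle_piP 1 0)); last by exists 1; rewrite add0r.
  by exists (n - m); rewrite rmorphB /=; ring.
by rewrite E0 E1 => /intr_inj.
Qed.

(** The projection is open: the saturation of an open set is a union of integer translates. *)
Lemma circle_pi_nbhs (t : R) (B : set R) :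
  nbhs t B -> nbhs (\pi_(circle R) t) (\pi_(circle R) @` B).
Proof.
rewrite nbhsE => -[U [oU Ut] UB].
rewrite nbhsE; exists (\pi_(circle R) @` U); last by move=> _ [s Us <-]; exists s => //; exact: UB.
split; last by exists t.
rewrite /open /= /quotient_open.
have -> : \pi_(circle R) @^-1` (\pi_(circle R) @` U) =
    \bigcup_(n : int) ((fun s : R => s + n%:~R) @^-1` U).
  apply/seteqP; split=> s /=.
    by move=> [r Ur /circle_piP[n rE]]; exists n => //=; rewrite -rE.
  move=> [n _ Usn]; exists (s + n%:~R) => //; apply/circle_piP; by exists n.
apply: bigcup_open => n _; apply: open_comp => // s _.
by apply: cvgD; [exact: cvg_id|exact: cvg_cst].
Qed.

(** The straight-line homotopy between the lifts descends to the torus, because both shift by the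
    same [u]. *)
Lemma lift_homotopic f g F G u : is_lift f F u -> is_lift g G u -> homotopic f g.
Proof.
move=> [cF lF pF] [cG lG pG].
pose K (p : R * R) : R * R :=
  ((1 - p.1) * (F p.2).1 + p.1 * (G p.2).1, (1 - p.1) * (F p.2).2 + p.1 * (G p.2).2).
have cK : continuous K.
  have cs : continuous (fun p : R * R => 1 - p.1).
    by move=> p; apply: cvgB; [exact: cvg_cst|exact: cvg_fst].
  have cc (E : R -> R * R) i : continuous E -> continuous (fun p : R * R => coord i (E p.2)).
    move=> cE; exact: (comp_continuous (f := fun p : R * R => E p.2)
      (comp_continuous (f := @snd R R) (@snd_continuous R R) cE) (@coord_cont R i)).
  apply: pair_continuous => p; apply: cvgD; apply: cvgM;
    by [exact: cs|exact: cvg_fst|exact: (cc F true)|exact: (cc F false)|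
        exact: (cc G true)|exact: (cc G false)].
have cpK : continuous (\pi_(torus R) \o K).
  by move=> p; exact: continuous_comp (cK p) (@pi_continuous _ _ _).
have Kper (s t : R) : \pi_(torus R) (K (s, t + 1)) = \pi_(torus R) (K (s, t)).
  apply/torus_piP; exists u; rewrite /K /= pF pG /=; congr (_, _); ring.
have Kn (s t : R) (n : nat) : \pi_(torus R) (K (s, t + n%:R)) = \pi_(torus R) (K (s, t)).
  by elim: n => [|n IH]; rewrite ?addr0 // -natr1 addrA Kper.
have Kz (s t : R) (n : int) : \pi_(torus R) (K (s, t + n%:~R)) = \pi_(torus R) (K (s, t)).
  case: n => n; first exact: Kn.
  rewrite NegzE rmorphN /= -(Kn s (t - _) n.+1); congr (\pi_(torus R) (K (_, _))).
  by rewrite subrK.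
exists (fun p => \pi_(torus R) (K (p.1, repr p.2))); split.
(* Neighbourhoods are pushed down from the line; [Kz] makes the choice of representative
   immaterial. *)
- apply: continuous_subspaceT => -[s x] V.
  rewrite /= => VK; have := cpK (s, repr x) _ VK.
  case=> -[A B] /= [As Bx] AB.
  exists (A, \pi_(circle R) @` B); first by split => //=; rewrite -[x]reprK; exact: circle_pi_nbhs.
  move=> [s' _] /= [As' [t Bt <-]].
  have [n ->] := repr_circle t; rewrite Kz.
  by apply: (AB (s', t)).
- move=> x; rewrite -[in RHS](reprK x) -lF /K /=; congr (\pi_(torus R) _).
  by rewrite subr0 !mul1r !mul0r !addr0 -surjective_pairing.
- move=> x; rewrite -[in RHS](reprK x) -lG /K /=; congr (\pi_(torus R) _).
  by rewrite subrr !mul1r !mul0r !add0r -surjective_pairing.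
Qed.

Lemma lift_opp f F u : is_lift f F u -> is_lift (f \o @circle_opp R) (fun t => F (- t)) (oppv u).
Proof.
move=> [cF lF pF]; split.
- by move=> t; apply: continuous_comp; [exact: opp_continuous|exact: cF].
- move=> t; rewrite lF /=; congr f; rewrite /circle_opp; apply/circle_piP.
  by have [n ->] := repr_circle t; exists n; ring.
- move=> t; have := pF (- (t + 1)); rewrite (_ : - (t + 1) + 1 = - t); last by ring.
  move=> -> /=; rewrite !rmorphN /= !addrK; exact: surjective_pairing.
Qed.

(** Reversing a curve negates its vector, so unoriented homotopy becomes equality of vectors up to
    sign. *)
Lemma curve_classP f F u g : is_lift f F u ->
  curve_class f g <-> simple_closed g /\ exists G v, is_lift g G v /\ (v = u \/ v = oppv u).
Proof.
move=> lF; split=> -[sg].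
  have [G [v lG]] := lift_exists (proj1 sg).
  move=> hfg; split=> //; exists G, v; split=> //; case: hfg => hfg.
    by left; rewrite (homotopic_lift_eq hfg lF lG).
  right; rewrite (homotopic_lift_eq hfg lF (lift_opp lG)) /oppv /= !opprK.
  exact: surjective_pairing.
move=> [G [v [lG vu]]]; split=> //; case: vu => vu; subst v.
  by left; exact: lift_homotopic lF lG.
right; have := lift_opp lG; rewrite (_ : oppv (oppv u) = u) => [lG'|].
  exact: lift_homotopic lF lG'.
by rewrite /oppv /= !opprK -surjective_pairing.
Qed.

Lemma curve_class_eq f F u g G v : is_lift f F u -> is_lift g G v ->
  u = v \/ u = oppv v -> curve_class f = curve_class g.
Proof.
move=> lF lG uv; apply/funext => h; apply/propext.
rewrite (curve_classP h lF) (curve_classP h lG).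
split=> -[sh [H [w [lH wE]]]]; split=> //; exists H, w; split => //; move: wE uv.
  by move=> [] -> [] ->; rewrite /oppv /= ?opprK -?surjective_pairing; [left|right|right|left].
move=> [] -> [] ->; rewrite /oppv /= ?opprK -?surjective_pairing; by [left|right|right|left].
Qed.

Lemma essential_lift f F u : essential f -> is_lift f F u -> u != (0, 0).
Proof.
move=> ef lF; apply/eqP => u0; apply: (ef (\pi_(torus R) (F 0))).
apply: lift_homotopic lF _; rewrite u0; split.
- by move=> t; exact: (cvg_cst (F 0)).
- by [].
- by move=> t; rewrite !mulr0z !addr0 -surjective_pairing.
Qed.
End Homotopy.

(** * Primitivity and intersection points *)

Local Open Scope card_scope.

Section Intersections.
Variable R : realType.
Implicit Types (f g : circle R -> torus R) (F G : R -> R * R) (u v w : int * int).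

Definition zvec u : R * R := (u.1%:~R, u.2%:~R).

Lemma periodic_extrema (phi : R -> R) : continuous phi -> (forall t, phi (t + 1) = phi t) ->
  exists a b, forall t, phi a <= phi t <= phi b.
Proof.
move=> cphi per; have cw := continuous_subspaceT cphi.
have [b _ Hb] := @EVT_max R phi 0 1 ler01 (cw _).
have [a _ Ha] := @EVT_min R phi 0 1 ler01 (cw _).
have pern t (n : nat) : phi (t + n%:R) = phi t.
  by elim: n => [|n IH]; rewrite ?addr0 // -natr1 addrA per.
have perz t (n : int) : phi (t + n%:~R) = phi t.
  case: n => n; first exact: pern.
  by rewrite NegzE rmorphN /= -[in LHS](pern _ n.+1) subrK.
exists a, b => t; have := floor_itv t; rewrite intrD => /andP[h1 h2].
have t01 : t - (Num.floor t)%:~R \in `[0, 1] by rewrite in_itv /=; apply/andP; split; lra.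
by have := Hb _ t01; have := Ha _ t01; rewrite -rmorphN perz => -> ->.
Qed.

Lemma lift_int f F u t (n : int) : is_lift f F u ->
  F (t + n%:~R) = ((F t).1 + n%:~R * u.1%:~R, (F t).2 + n%:~R * u.2%:~R).
Proof.
case=> _ _ pF.
have pn (s : R) (m : nat) : F (s + m%:R) = ((F s).1 + m%:R * u.1%:~R, (F s).2 + m%:R * u.2%:~R).
  elim: m => [|m IH]; first by rewrite !mul0r !addr0 -surjective_pairing.
  by rewrite -natr1 addrA pF IH /=; congr (_, _); ring.
case: n => n; first exact: pn.
rewrite NegzE rmorphN /=; have := pn (t - n.+1%:R) n.+1; rewrite subrK => ->.
by rewrite [LHS]surjective_pairing /=; congr (_, _); ring.
Qed.

Lemma det2_continuous (T : topologicalType) (E : T -> R * R) (z : R * R) :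
  continuous E -> continuous (fun t => det2 (E t) z).
Proof.
move=> cE t; apply: cvgB; apply: cvgM; try exact: cvg_cst.
  exact: (comp_continuous cE (@fst_continuous R R)).
exact: (comp_continuous cE (@snd_continuous R R)).
Qed.

(* If [u = m w] with [m > 1], the chords [F (s + c) - F s] join [0] to [m w];
   they pass below [w] when [s] maximises the height over the line [R w] and
   above it when [s] minimises it, so some chord equals [w]. *)
Lemma simple_lift_primitive f F u :
  injective f -> is_lift f F u -> u != (0, 0) -> coprimez u.1 u.2.
Proof.
move=> fI lF u0; have [cF liftF pF] := lF.
pose m := gcdz u.1 u.2.
have m0 : 0 < m.
  rewrite lt_def gcdz_eq0 andbT; apply: contraNN u0 => /andP[/eqP u1 /eqP u2].
  by rewrite [u]surjective_pairing u1 u2.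
apply: contraT => ncop.
have m2 : 2 <= m by move: ncop; rewrite /coprimez -/m; lia.
pose w := ((u.1 %/ m)%Z, (u.2 %/ m)%Z).
have uw1 : u.1 = w.1 * m by rewrite divzK // dvdz_gcdl.
have uw2 : u.2 = w.2 * m by rewrite divzK // dvdz_gcdr.
pose x : R := w.1%:~R; pose y : R := w.2%:~R; pose M : R := m%:~R.
have M2 : 2 <= M by rewrite (ler_int R 2).
have u1R : u.1%:~R = x * M by rewrite uw1 rmorphM.
have u2R : u.2%:~R = y * M by rewrite uw2 rmorphM.
have N0 : 0 < x * x + y * y.
  rewrite lt_def addr_ge0 ?andbT -?expr2 ?sqr_ge0 // paddr_eq0 ?sqr_ge0 // !sqrf_eq0 !intr_eq0.
  apply: contraNN u0 => /andP[/eqP w1 /eqP w2].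
  by rewrite [u]surjective_pairing uw1 uw2 w1 w2 !mul0r.
pose phi t := det2 (F t) (x, y).
have [smin [smax Hphi]] : exists a b, forall t, phi a <= phi t <= phi b.
  apply: periodic_extrema; first exact: det2_continuous.
  by move=> t; rewrite /phi pF /det2 /= u1R u2R; ring.
(* [p.1] is the length of the parameter interval, and [p.2] moves its start from [smin] to [smax].
   The components of [h] compare the chord [psi p] with [w] along [w] and across it. *)
pose s (p : R * R) := smin + p.2 * (smax - smin).
pose psi (p : R * R) := ((F (s p + p.1)).1 - (F (s p)).1, (F (s p + p.1)).2 - (F (s p)).2).
pose h (p : R * R) := (x * ((psi p).1 - x) + y * ((psi p).2 - y), - det2 (psi p) (x, y)).
have cs : continuous s.
  by move=> p; apply: cvgD; [exact: cvg_cst|apply: cvgMl; exact: cvg_snd].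
have csc : continuous (fun p => s p + p.1).
  by move=> p; apply: cvgD; [exact: cs|exact: cvg_fst].
have cpsi i : continuous (fun p => coord i (psi p)).
  have cc (r : R * R -> R) : continuous r -> continuous (fun p => coord i (F (r p))).
    by move=> cr; exact: (comp_continuous (comp_continuous cr cF) (@coord_cont R i)).
  by case: i cc => cc p; apply: cvgB;
    [exact: cc csc _|exact: cc cs _|exact: cc csc _|exact: cc cs _].
have chh : continuous h.
  apply: pair_continuous => p.
    apply: cvgD; apply: cvgM; try exact: cvg_cst.
      by apply: cvgB; [exact: (cpsi true)|exact: cvg_cst].
    by apply: cvgB; [exact: (cpsi false)|exact: cvg_cst].
  apply: cvgN; apply: cvgB; apply: cvgM; try exact: cvg_cst.
    exact: (cpsi true).
  exact: (cpsi false).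
have [t t01|p [p1 p2] hp] := poincare_miranda chh.
  rewrite /h /psi /s /=; split.
  - by rewrite addr0 !subrr !sub0r !mulrN; move: N0; lra.
  - rewrite !pF u1R u2R /=; set a := (F _).1; set b := (F _).2.
    rewrite (_ : _ + _ = (M - 1) * (x * x + y * y)); last by ring.
    by apply: mulr_gt0 => //; lra.
  - rewrite mul0r addr0; have /andP[+ _] := Hphi (smin + t).
    by rewrite /phi /det2 /=; lra.
  - rewrite mul1r subrKC; have /andP[_] := Hphi (smax + t).
    by rewrite /phi /det2 /=; lra.
have [hx hy] : (psi p).1 = x /\ (psi p).2 = y.
  have e1 : x * ((psi p).1 - x) + y * ((psi p).2 - y) = 0 := congr1 fst hp.
  have e2 : (psi p).1 * y - (psi p).2 * x = 0.
    by apply: oppr_inj; rewrite oppr0; exact: (congr1 snd hp).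
  move: (psi p) e1 e2 => [a b] /= e1 e2; split; apply: (mulfI (lt0r_neq0 N0)).
    have -> : (x * x + y * y) * a =
        x * (x * (a - x) + y * (b - y)) + y * (a * y - b * x) + x * (x * x + y * y) by ring.
    by rewrite e1 e2; ring.
  have -> : (x * x + y * y) * b =
      y * (x * (a - x) + y * (b - y)) - x * (a * y - b * x) + y * (x * x + y * y) by ring.
  by rewrite e1 e2; ring.
(* A chord equal to [w] closes up on the torus, so by injectivity [p.1] is 0 or 1; but then the
   chord is 0 or [u], not [w]. *)
have E : \pi_(circle R) (s p + p.1) = \pi_(circle R) (s p).
  apply: fI; rewrite -!liftF; apply/torus_piP; exists w.
  by rewrite [LHS]surjective_pairing -/x -/y -hx -hy /psi /=; congr (_, _); ring.
have /circle_piP[n nE] := E.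
have {nE}nE : p.1 = n%:~R by lra.
move: p1; rewrite nE -[0]/(0%:~R) -[1]/(1%:~R) !ler_int => n01.
move: hx hy; rewrite /psi nE (lift_int _ _ lF) /= u1R u2R.
have [->|->] : n = 0 \/ n = 1 by lia.
  by rewrite mulr0z !mul0r !addr0 !subrr => x0 y0; move: N0; rewrite -x0 -y0 !mul0r addr0 ltxx.
rewrite !mul1r => x1 y1; have : (M - 1) * (x * x + y * y) = 0.
  rewrite (_ : _ * _ = x * (x * M - x) + y * (y * M - y)); last by ring.
  by rewrite (_ : x * M - x = 0) 1?(_ : y * M - y = 0) ?mulr0 ?addr0 //; lra.
by move=> e; have : 0 < (M - 1) * (x * x + y * y); [apply: mulr_gt0 => //; lra | rewrite e ltxx].
Qed.

(** Measured by [det2 _ V / D] and [det2 _ U / D], the difference [F t - G s - w] grows by 1 in the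
    first with each period of [t] and in the second with each period of [s], up to bounded terms. A
    large parameter square therefore meets the sign conditions of Poincare-Miranda. *)
Lemma lifts_meet f g F G u v w : is_lift f F u -> is_lift g G v -> det2 u v != 0 ->
  exists t s, F t = ((G s).1 + w.1%:~R, (G s).2 + w.2%:~R).
Proof.
move=> lF lG D0; have [cF _ pF] := lF; have [cG _ pG] := lG.
pose U := zvec u; pose V := zvec v; pose W := zvec w.
pose D : R := det2 U V.
have D1 : 1 <= `|D|.
  have -> : D = (det2 u v)%:~R by rewrite /D /det2 rmorphB !rmorphM.
  by rewrite -intr_norm -[1]/(1%:~R) ler_int; move: D0; lia.
have DN0 : D != 0 by apply: contraTneq D1 => ->; rewrite normr0 ler10.
have [a1 [b1 H1]] : exists a b, forall t, det2 (F a) U <= det2 (F t) U <= det2 (F b) U.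
  apply: (periodic_extrema (phi := fun t => det2 (F t) U)); first exact: det2_continuous.
  by move=> t; rewrite pF /det2 /=; ring.
have [a2 [b2 H2]] : exists a b, forall t, det2 (G a) V <= det2 (G t) V <= det2 (G b) V.
  apply: (periodic_extrema (phi := fun t => det2 (G t) V)); first exact: det2_continuous.
  by move=> t; rewrite pG /det2 /=; ring.
(* [K] bounds the terms that do not grow with [N]; dividing them by [D] does not enlarge them. *)
pose K := `|det2 (F a1) U| + `|det2 (F b1) U| + `|det2 (G a2) V| + `|det2 (G b2) V| +
  `|det2 (F 0) V| + `|det2 (G 0) U| + `|det2 W U| + `|det2 W V|.
have [N KN] : exists N : nat, K < N%:R by exists (Num.truncn K).+1; exact: truncnS_gt.
have small r : `|r| <= K -> - N%:R < r / D < N%:R.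
  move=> rK; rewrite -ltr_norml normrM normfV; apply: le_lt_trans KN; apply: le_trans rK.
  by rewrite ler_piMr // invf_le1 // (lt_le_trans ltr01).
pose t (x : R) := N%:R * (2 * x - 1).
have t0 : t 0 = 0 + (- N%:Z)%:~R by rewrite /t rmorphN /=; ring.
have t1 : t 1 = 0 + (N%:Z)%:~R by rewrite /t /=; ring.
have ct : continuous t.
  by move=> x; apply: cvgMr; apply: cvgB; [apply: cvgMr; exact: cvg_id|exact: cvg_cst].
pose delta (p : R * R) : R * R := ((F (t p.1)).1 - (G (t p.2)).1 - w.1%:~R,
  (F (t p.1)).2 - (G (t p.2)).2 - w.2%:~R).
have cdelta : continuous delta.
  have cc (E : R -> R * R) (i j : bool) : continuous E ->
      continuous (fun p : R * R => coord i (E (t (coord j p)))).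
    move=> cE; have cj := comp_continuous (@coord_cont R j) ct.
    exact: (comp_continuous (comp_continuous cj cE) (@coord_cont R i)).
  apply: pair_continuous => p; apply: cvgB; try exact: cvg_cst; apply: cvgB.
  - exact: (cc F true true).
  - exact: (cc G true false).
  - exact: (cc F false true).
  - exact: (cc G false false).
pose h (p : R * R) := (det2 (delta p) V / D, det2 (delta p) U / D).
have chh : continuous h.
  by apply: pair_continuous => p; apply: cvgMl; exact: det2_continuous.
have side (a b x y z : R) : `|y| + `|z| + `|a| + `|b| <= K -> a <= x <= b -> `|y - x - z| <= K.
  move=> H /andP[h1 h2]; apply: le_trans H; rewrite ler_norml.
  have := ler_norm y; have := ler_norm (- y); have := ler_norm z; have := ler_norm (- z).
  have := ler_norm b; have := ler_norm (- a); rewrite !normrN => *.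
  have := normr_ge0 a; have := normr_ge0 b => *; apply/andP; split; lra.
have side' (a b x y z : R) : `|y| + `|z| + `|a| + `|b| <= K -> a <= x <= b -> `|x - y - z| <= K.
  move=> H /andP[h1 h2]; apply: le_trans H; rewrite ler_norml.
  have := ler_norm y; have := ler_norm (- y); have := ler_norm z; have := ler_norm (- z).
  have := ler_norm b; have := ler_norm (- a); rewrite !normrN => *.
  have := normr_ge0 a; have := normr_ge0 b => *; apply/andP; split; lra.
have Kpos (x : R) := normr_ge0 x.
have SV y : - N%:R < (det2 (F 0) V - det2 (G y) V - det2 W V) / D < N%:R.
  apply: small; apply: side (H2 y); rewrite /K.
  have := Kpos (det2 (F a1) U); have := Kpos (det2 (F b1) U).
  by have := Kpos (det2 (G 0) U); have := Kpos (det2 W U); lra.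
have SU y : - N%:R < (det2 (F y) U - det2 (G 0) U - det2 W U) / D < N%:R.
  apply: small; apply: side' (H1 y); rewrite /K.
  have := Kpos (det2 (G a2) V); have := Kpos (det2 (G b2) V).
  by have := Kpos (det2 (F 0) V); have := Kpos (det2 W V); lra.
have [x x01|p _ hp] := poincare_miranda chh.
  split; rewrite /h /delta /= ?t0 ?t1 ?(lift_int _ _ lF) ?(lift_int _ _ lG) ?rmorphN /=.
  - have /andP[_] := SV (t x); rewrite (_ : det2 (_, _) V / D =
      (det2 (F 0) V - det2 (G (t x)) V - det2 W V) / D - N%:R); first by lra.
    by rewrite -[N%:R](mulfK DN0) -mulrBl; congr (_ / _); rewrite /D /det2 /U /V /W /=; ring.
  - have /andP[+ _] := SV (t x); rewrite (_ : det2 (_, _) V / D =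
      (det2 (F 0) V - det2 (G (t x)) V - det2 W V) / D + N%:R); first by lra.
    by rewrite -[N%:R](mulfK DN0) -mulrDl; congr (_ / _); rewrite /D /det2 /U /V /W /=; ring.
  - have /andP[_] := SU (t x); rewrite (_ : det2 (_, _) U / D =
      (det2 (F (t x)) U - det2 (G 0) U - det2 W U) / D - N%:R); first by lra.
    by rewrite -[N%:R](mulfK DN0) -mulrBl; congr (_ / _); rewrite /D /det2 /U /V /W /=; ring.
  - have /andP[+ _] := SU (t x); rewrite (_ : det2 (_, _) U / D =
      (det2 (F (t x)) U - det2 (G 0) U - det2 W U) / D + N%:R); first by lra.
    by rewrite -[N%:R](mulfK DN0) -mulrDl; congr (_ / _); rewrite /D /det2 /U /V /W /=; ring.
have zero (z : R) : z / D = 0 -> z = 0.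
  by move=> /eqP; rewrite mulf_eq0 invr_eq0 (negbTE DN0) orbF => /eqP.
have /zero e1 : det2 (delta p) V / D = 0 := congr1 fst hp.
have /zero e2 : det2 (delta p) U / D = 0 := congr1 snd hp.
exists (t p.1), (t p.2).
suff [h1 h2] : (delta p).1 = 0 /\ (delta p).2 = 0.
  rewrite [LHS]surjective_pairing; move: h1 h2; rewrite /delta /= => h1 h2.
  by congr (_, _); lra.
move: (delta p) e1 e2 => [a b] e1 e2 /=; split; apply: (mulfI DN0); rewrite mulr0.
  have -> : D * a = U.1 * det2 (a, b) V - V.1 * det2 (a, b) U by rewrite /D /det2 /=; ring.
  by rewrite e1 e2 !mulr0 subrr.
have -> : D * b = U.2 * det2 (a, b) V - V.2 * det2 (a, b) U by rewrite /D /det2 /=; ring.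
by rewrite e1 e2 !mulr0 subrr.
Qed.

(** The translates [i * (- s, r)] have determinant [i] with [u], so for [i] below the size of
    [det2 u v] they are distinct modulo the lattice of [u] and [v]. Each yields a common point, and
    equal points would make two translates congruent. *)
Lemma intersection_ge f g F G u v : injective f -> injective g ->
    is_lift f F u -> is_lift g G v -> coprimez u.1 u.2 -> det2 u v != 0 ->
  `I_`|det2 u v|%N #<= range f `&` range g.
Proof.
move=> fI gI lF lG /coprimezP[[r s] /= rs] D0.
have [_ liftF _] := lF; have [_ liftG _] := lG.
pose meet (i : nat) (ts : R * R) := F ts.1 =
  ((G ts.2).1 + (- i%:Z * s)%:~R, (G ts.2).2 + (i%:Z * r)%:~R).
have /boolp.choice[ts Hts] : forall i, exists ts, meet i ts.
  move=> i; have [t [s' E]] := lifts_meet (- i%:Z * s, i%:Z * r) lF lG D0.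
  by exists (t, s').
pose P (i : nat) := \pi_(torus R) (F (ts i).1).
have PG i : P i = \pi_(torus R) (G (ts i).2).
  by apply/torus_piP; exists (- i%:Z * s, i%:Z * r); exact: Hts.
have PI : {in `I_`|det2 u v|%N &, injective P}.
  move=> i j; rewrite !inE /= => iD jD Pij.
  have /fI/circle_piP[a aE] : f (\pi_(circle R) (ts i).1) = f (\pi_(circle R) (ts j).1).
    by rewrite -!liftF.
  have /gI/circle_piP[b bE] : g (\pi_(circle R) (ts i).2) = g (\pi_(circle R) (ts j).2).
    by rewrite -!liftG -!PG.
  have := Hts i; rewrite /meet aE bE (lift_int _ _ lF) (lift_int _ _ lG) (Hts j) /= => -[E1 E2].
  have Z1 : - j%:Z * s + a * u.1 = b * v.1 + - i%:Z * s.
    by apply: (@intr_inj R); rewrite !intrD (intrM _ a) (intrM _ b); move: E1; lra.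
  have Z2 : j%:Z * r + a * u.2 = b * v.2 + i%:Z * r.
    by apply: (@intr_inj R); rewrite !intrD (intrM _ a) (intrM _ b); move: E2; lra.
  (* The determinant with [u] eliminates [a]. *)
  have : (i%:Z - j%:Z) = - b * det2 u v.
    rewrite -[LHS]mulr1 -rs.
    have e1 : (i%:Z - j%:Z) * s = b * v.1 - a * u.1 by move: Z1; clear; lra.
    have e2 : (i%:Z - j%:Z) * r = a * u.2 - b * v.2 by move: Z2; clear; lra.
    rewrite mulrDr mulrA e2 mulrA e1 /det2; ring.
  move: (det2 u v) iD jD D0 => D iD jD D0 /eqP; clear - iD jD D0.
  have [->|b0 /eqP ijD] := eqVneq b 0; first by rewrite oppr0 mul0r; lia.
  have /(congr1 absz) := ijD; rewrite abszM abszN => E.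
  have : (`|D| <= `|(i%:Z - j%:Z)%R|)%N by rewrite E leq_pmull // absz_gt0.
  lia.
rewrite -(card_le_eql (inj_card_eq PI)); apply: subset_card_le => _ [i _ <-].
by split; [exists (\pi_(circle R) (ts i).1); rewrite // -liftF
          |exists (\pi_(circle R) (ts i).2); rewrite // PG liftG].
Qed.
End Intersections.

(** * Slopes of a k-system *)

Section Slopes.
Variable R : realType.
Implicit Types (a b : set (circle R -> torus R)) (u v : int * int).

Definition has_slope a u : Prop := exists f F,
  [/\ simple_closed f, a = curve_class f, is_lift f F u & coprimez u.1 u.2].

Lemma curve_has_slope a : is_curve a -> exists u, has_slope a u.
Proof.
move=> [f [sf ef ->]]; have [F [u lF]] := lift_exists (proj1 sf).
exists u, f, F; split => //.
exact: simple_lift_primitive (proj2 sf) lF (essential_lift ef lF).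
Qed.

Lemma has_slope_inj a b u v : has_slope a u -> has_slope b v ->
  u = v \/ u = oppv v -> a = b.
Proof.
by move=> [f [F [_ -> lF _]]] [g [G [_ -> lG _]]]; exact: curve_class_eq lF lG.
Qed.

Lemma norm_det2_oppv u v u' v' : (u' = u \/ u' = oppv u) -> (v' = v \/ v' = oppv v) ->
  `|det2 u' v'| = `|det2 u v|.
Proof.
rewrite /oppv => -[] -> [] -> //; rewrite /det2 /= ?mulrNN ?mulrN ?mulNr //.
- by rewrite -opprD normrN.
- by rewrite -opprD normrN.
Qed.

Lemma coprime_oppv u : coprimez u.1 u.2 -> coprimez (oppv u).1 (oppv u).2.
Proof. by rewrite /oppv /= coprimezN coprimeNz. Qed.

(** The number [n] is attained by representatives, whose lifts have vectors [u] and [v] up to sign;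
    [intersection_ge] applies to these. *)
Lemma slope_det_le a b u v n : has_slope a u -> has_slope b v ->
  is_intersection_number a b n -> `|det2 u v| <= n%:Z.
Proof.
move=> [f [F [_ -> lF cu]]] [g [G [_ -> lG cv]]] [[f' [g' [af' bg' E]]] _].
have [sf' [F' [u' [lF' uu']]]] := iffLR (curve_classP f' lF) af'.
have [sg' [G' [v' [lG' vv']]]] := iffLR (curve_classP g' lG) bg'.
rewrite -(norm_det2_oppv uu' vv'); have [->|D0] := eqVneq (det2 u' v') 0; first by rewrite normr0.
have cu' : coprimez u'.1 u'.2 by case: uu' => ->; rewrite ?coprime_oppv.
have := intersection_ge (proj2 sf') (proj2 sg') lF' lG' cu' D0.
by rewrite (card_le_eqr E) card_le_II -lez_nat abszE.
Qed.

Lemma k_system_slopes k S (L : seq (set (circle R -> torus R))) : k_system k S ->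
    uniq L -> (forall a, a \in L -> S a) ->
  exists V : seq (int * int), [/\ size V = size L, uniq V,
    forall v, v \in V -> coprimez v.1 v.2,
    forall u v, u \in V -> v \in V -> u <> oppv v &
    forall u v, u \in V -> v \in V -> `|det2 u v| <= k%:Z].
Proof.
move=> [curves inter] uL LS.
(* Outside [S] the value [(0, 0)] is a default. *)
have /boolp.choice[sl Hsl] : forall a, exists u, S a -> has_slope a u.
  move=> a; have [Sa|nSa] := pselect (S a); last by exists (0, 0).
  by have [u] := curve_has_slope (curves a Sa); exists u.
have slL a : a \in L -> has_slope a (sl a) by move=> /LS /Hsl.
have slc a : a \in L -> coprimez (sl a).1 (sl a).2.
  by move=> /slL [f [F []]].
exists [seq sl a | a <- L]; split.
- by rewrite size_map.
- rewrite map_inj_in_uniq // => a b aL bL E.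
  by apply: has_slope_inj (slL a aL) (slL b bL) _; left.
- by move=> _ /mapP[a aL ->]; exact: slc.
(* Opposite vectors belong to the same curve, whose vector would then be its own opposite, hence 0
   and not coprime. *)
- move=> _ _ /mapP[a aL ->] /mapP[b bL ->] E.
  have ab : a = b by apply: has_slope_inj (slL a aL) (slL b bL) _; right.
  move: (slc a aL) E; rewrite -ab; case: (sl a) => x y /= cxy [x0 y0].
  by move: cxy; have -> : x = 0 by [lia]; have -> : y = 0 by [lia].
- move=> _ _ /mapP[a aL ->] /mapP[b bL ->].
  have [->|/eqP ab] := eqVneq a b; first by rewrite /det2 mulrC subrr normr0.
  have [n nk Hn] := inter a b (LS a aL) (LS b bL) ab.
  by apply: le_trans (slope_det_le (slL a aL) (slL b bL) Hn) _.
Qed.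

(** A bound on finite lists rules out infinite systems too, as these contain [N.+1] distinct curves;
    so a largest attained size exists. *)
Lemma is_eta_exists k N :
    (forall S (L : seq (set (circle R -> torus R))), k_system k S -> uniq L ->
       (forall a, a \in L -> S a) -> (size L <= N)%N) ->
  exists2 n, (n <= N)%N & is_eta R k n.
Proof.
move=> H.
have finS S : @k_system R k S -> exists2 n, (n <= N)%N & S #= `I_n.
  move=> kS; have [fS|iS] := pselect (finite_set S); last first.
    have [B BS BN] := infinite_set_fset N.+1 iS.
    have := H S (enum_fset B) kS (fset_uniq B) _.
    by rewrite leqNgt BN => /(_ _)/negP; case=> // a aB; exact: BS.
  have /finite_setP[n Sn] := fS; exists n => //.
  rewrite -(card_fset_set Sn); apply: H kS (fset_uniq _) _ => a.
  by move=> aS; apply: set_mem; rewrite -(in_fset_set fS).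
pose P n := `[< exists2 S, @k_system R k S & S #= `I_n >].
have P0 : exists n, P n.
  by exists 0%N; apply/asboolP; exists set0; [split|rewrite II0].
have PN n : P n -> (n <= N)%N.
  move=> /asboolP[S /finS[m mN Sm] Sn].
  suff -> : n = m by [].
  apply/card_eq_II; apply: card_eq_trans Sm.
  by rewrite card_eq_sym.
case: (ex_maxnP P0 PN) => n Pn nmax; exists n; first exact: PN.
split; first exact/asboolP.
move=> S kS; have [m _ Sm] := finS S kS; rewrite (card_le_eql Sm) card_le_II.
by apply: nmax; apply/asboolP; exists S.
Qed.
End Slopes.

Theorem theorem1p1 (R : realType) :
  exists C : R, 0 < C /\
    forall k : nat, (2 <= k)%N ->
      exists n : nat, is_eta R k n /\
        n%:R <= k%:R + C * Num.sqrt k%:R * ln k%:R.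
Proof.
have [C [C0 HC]] := slopes_bound R; exists C; split=> // k k2.
set B := k%:R + _.
have B0 : 0 <= B.
  rewrite addr_ge0 // !mulr_ge0 ?sqrtr_ge0 ?ltW // ln_gt0 // ltr1n //.
(* Sizes are natural numbers, so the nonnegative real bound [B] can be truncated. *)
have [|n nB eta] := @is_eta_exists R k (Num.truncn B).
  move=> S L kS uL LS; have [V [<- uV cV nV dV]] := k_system_slopes kS uL LS.
  by rewrite truncn_ge_nat //; exact: HC.
exists n; split=> //; by rewrite -truncn_ge_nat.
Qed.
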